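(* Let $f$ be a bounded multivariate rational function on $\mathbb{R}^n$, and let $\{\mathbf{x}_k\}_{k=1}^{\infty} \subset \mathbb{R}^n$ be a sequence of points in the domain of $f$ such that $\{f(\mathbf{x}_k)\}_{k=1}^{\infty}$ is monotonic. Suppose that $\mathbf{x}^*$ is a cluster point of the sequence $\{\mathbf{x}_k\}_{k=1}^{\infty}$ and there exists a closed set $V \subset \mathcal{O}_{\mathbf{x}^*}$ ($V$ closed in $\mathbb{R}^n$) such that for all sufficiently large $k$, $$\frac{\mathbf{x}_k - \mathbf{x}^*}{\|\mathbf{x}_k - \mathbf{x}^*\|} \in V .$$ Then there exist an open neighborhood $U$ of $\mathbf{x}^*$ and constants $\theta \in (0, 1/2]$ and $c \in \mathbb{R}$ such that if $k$ is sufficiently large and if $\mathbf{x}_k \in U$, then $$\left| f(\mathbf{x}_k) - \lim_{i \to \infty} f(\mathbf{x}_i) \right|^{1-\theta} \le c \|\nabla f(\mathbf{x}_k)\| .$$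
   Context: A multivariate rational function on $\mathbb{R}^n$ is a function $r = p/q$ with $p, q : \mathbb{R}^n \to \mathbb{R}$ multivariate polynomials; its domain is the set of all points of $\mathbb{R}^n$ at which $q \neq 0$ (no division by zero occurs). Bounded means bounded on this domain. The point $\mathbf{x}^*$ need not lie in the domain of $f$. Given a bounded multivariate rational function $f = p/q$ on $\mathbb{R}^n$ (with $q$ not identically zero) and a point $\mathbf{x}^* \in \mathbb{R}^n$, let $f_j(\mathbf{x})$ denote the $j$-th Maclaurin series coefficient, with respect to $t$, of the denominator $q(t\mathbf{x} + \mathbf{x}^* )$ of the rational function $(\mathbf{x}, t) \mapsto f(t\mathbf{x} + \mathbf{x}^* )$. Define $$\mathcal{O}_{\mathbf{x}^*} = \{\mathbf{x} \in \mathbb{R}^n : f_{n_{\min}}(\mathbf{x}) \neq 0\}, \qquad n_{\min} = \min\{ j \in \mathbb{Z}_{\ge 0} : \exists\, \mathbf{x} \in \mathbb{R}^n,\ f_j(\mathbf{x}) \neq 0 \}.$$ $\|\cdot\|$ is the Euclidean norm. *)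

(* Defs.v *)
From mathcomp Require Import all_boot all_order all_algebra.
From mathcomp Require Import all_classical all_reals all_analysis.
(* Only the canonical instances of mpoly are imported, since its notations clash
   with those of mathcomp-analysis: [mpoly.mpoly n R] is {mpoly R[n]} and
   [mpoly.meval v p] is p.@[v]. *)
From mathcomp Require mpoly.
Import (canonicals) mpoly.

Set Implicit Arguments.
Unset Strict Implicit.
Unset Printing Implicit Defensive.

Import Order.TTheory GRing.Theory Num.Theory.
Import numFieldNormedType.Exports.

Local Open Scope classical_set_scope.
Local Open Scope ring_scope.

Definition peval (R : realType) (n : nat) (p : mpoly.mpoly n R) (x : 'rV[R]_n) : R :=
  mpoly.meval (x 0) p.

Definition ratdom (R : realType) (n : nat) (q : mpoly.mpoly n R) : set 'rV[R]_n :=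
  [set x | peval q x != 0].

(* Meaningful on [ratdom q] only. *)
Definition ratfun (R : realType) (n : nat) (p q : mpoly.mpoly n R)
    (x : 'rV[R]_n) : R :=
  peval p x / peval q x.

(* The library norm on 'rV[R]_n is the sup norm; it induces the same topology
   as the Euclidean norm. *)
Definition enorm (R : realType) (n : nat) (x : 'rV[R]_n) : R :=
  Num.sqrt (\sum_(i < n) x 0 i ^+ 2).

Definition grad (R : realType) (n : nat) (f : 'rV[R]_n -> R) (x : 'rV[R]_n) :
    'rV[R]_n :=
  \row_(i < n) 'D_(delta_mx 0 i) f x.

(* j-th Maclaurin coefficient of t |-> q (t x + a). *)
Definition maclaurin_coef (R : realType) (n : nat) (q : mpoly.mpoly n R)
    (a : 'rV[R]_n) (j : nat) (x : 'rV[R]_n) : R :=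
  derive1n j (fun t : R => peval q (t *: x + a)) 0 / j`!%:R.

(* The least j for which the j-th coefficient is not identically zero in x;
   such a j exists as soon as q != 0 (the default value 0 is then unused). *)
Definition nmin (R : realType) (n : nat) (q : mpoly.mpoly n R)
    (a : 'rV[R]_n) : nat :=
  xget 0%N [set j : nat |
    (exists x, maclaurin_coef q a j x != 0) /\
    forall i : nat, (exists x, maclaurin_coef q a i x != 0) -> (j <= i)%N].

Definition Oset (R : realType) (n : nat) (q : mpoly.mpoly n R)
    (a : 'rV[R]_n) : set 'rV[R]_n :=
  [set x | maclaurin_coef q a (nmin q a) x != 0].

(* Main.v *)
Require Import Defs.
From mathcomp Require Import all_boot all_order all_algebra.
From mathcomp Require Import all_classical all_reals all_analysis.
From mathcomp Require mpoly.
From mathcomp Require ordered_qelim qe_rcf.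
From mathcomp Require Import polyrcf.
From mathcomp Require Import ring lra zify.
Import (canonicals) mpoly.

Set Implicit Arguments.
Unset Strict Implicit.
Unset Printing Implicit Defensive.

Import Order.TTheory GRing.Theory Num.Theory.
Import numFieldNormedType.Exports.

Local Open Scope classical_set_scope.
Local Open Scope ring_scope.

(** Write [f = p / q] and let [a] be the cluster point. In polar coordinates
    [x = t *: v + a] both [p] and [q] become polynomials in [(t, v)], and [q]
    becomes [t ^+ m * Q (t, v)], where [m] is the order of vanishing of [q] at
    [a] and [Q (0, v)] is the initial form whose nonvanishing set is
    [Oset q a] ([maclaurin_coefE], [ev_iter_quo]). Since [f] is bounded, [p]
    vanishes along [t = 0] to order at least [m] ([bounded_vanishing_order]), so
    [p = t ^+ m * P] and [f] is the quotient [P / Q] of two polynomials whose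
    denominator is bounded away from [0] when [t] is small and [v] is a unit
    vector of the closed set [V] ([closed_unit_lower_bound]). With [L] the limit
    of the values of [f] along the sequence, put [h = P - L * Q]. A Lojasiewicz
    gradient inequality for the polynomial [h], valid on a whole ball, transfers
    to [f]: each partial derivative of [h] is [Q] times one of [P / Q], which the
    gradient of [f] controls, plus an error of size [|h|], which is negligible
    compared with [|h| `^ (1 - theta)] ([powR_absorb], [blowup_lojasiewicz]).

    The gradient inequality for a polynomial [h] on a ball
    ([lojasiewicz_gradient]) comes from quantifier elimination. For a level
    [s > 0] consider the numbers [w] such that some point [z] of the ball has
    [h z = s] and [w * |grad h z| <= s]; these pairs [(s, w)] form a definable
    plane set. Two facts are needed.

    First, such [w] tend to [0] with [s] ([no_slow_points]). Otherwise, for some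
    fixed [w > 0] and all small [s], there is a point [xi s] in the ball on the
    level [s] at which [log h] has slope at most [1 / w]; it can be chosen
    definably, by minimizing the coordinates one after the other
    ([definable_selection]). By quantifier elimination, the number of crossings
    of each coordinate of [xi] with a constant is bounded independently of the
    constant, so [xi] has finite total variation ([selection_variation_le]). But
    [log h] goes to minus infinity along [xi] with bounded slope, which forces
    the variation to be infinite ([slow_increment_ge]).

    Second, the boundary of a definable plane set lies on algebraic curves, and a
    branch of an algebraic curve [F (s, w) = 0] on which [w] is small satisfies
    [w ^+ j <= C * s] for some [j] ([curve_branch_bound],
    [definable_power_bound]). Applied to [w = s / |grad h z|] this reads
    [s `^ (1 - 1 / j) <= C' * |grad h z|]. *)

(** * Polynomial expressions *)

(** Syntax trees over an arbitrary set of variables: they can be evaluated in any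
    commutative ring, translated into first-order terms, and differentiated or
    divided by a variable by structural recursion. *)
Inductive pexp (R V : Type) : Type :=
| PC of R
| PX of V
| PA of pexp R V & pexp R V
| PM of pexp R V & pexp R V.
Arguments PC {R V}.
Arguments PX {R V}.

Fixpoint pev (R V : Type) (S : comNzRingType) (phi : R -> S) (e : V -> S)
    (P : pexp R V) : S :=
  match P with
  | PC c => phi c
  | PX i => e i
  | PA P1 P2 => pev phi e P1 + pev phi e P2
  | PM P1 P2 => pev phi e P1 * pev phi e P2
  end.

Notation ev := (pev id).

Fixpoint psubst (R V W : Type) (s : V -> pexp R W) (P : pexp R V) : pexp R W :=
  match P with
  | PC c => PC c
  | PX i => s i
  | PA P1 P2 => PA (psubst s P1) (psubst s P2)
  | PM P1 P2 => PM (psubst s P1) (psubst s P2)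
  end.

Fixpoint pd (R : nzRingType) (V : eqType) (i : V) (P : pexp R V) : pexp R V :=
  match P with
  | PC _ => PC 0
  | PX j => PC (j == i)%:R
  | PA P1 P2 => PA (pd i P1) (pd i P2)
  | PM P1 P2 => PA (PM (pd i P1) P2) (PM P1 (pd i P2))
  end.

(** The quotient in Hadamard's lemma: [P = P(X_i := 0) + X_i * var_quo i P]. *)
Fixpoint var_quo (R : nzRingType) (V : eqType) (i : V) (P : pexp R V) : pexp R V :=
  match P with
  | PC _ => PC 0
  | PX j => PC (j == i)%:R
  | PA P1 P2 => PA (var_quo i P1) (var_quo i P2)
  | PM P1 P2 =>
      PA (PM (var_quo i P1) P2)
         (PM (psubst (fun j => if j == i then PC 0 else PX j) P1) (var_quo i P2))
  end.

Section PexpAlgebra.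
Variables (R : comNzRingType) (V : Type).

Lemma rmorph_pev (S T : comNzRingType) (phi : R -> S) (e : V -> S)
    (psi : {rmorphism S -> T}) (P : pexp R V) :
  psi (pev phi e P) = pev (psi \o phi) (psi \o e) P.
Proof. by elim: P => //= P1 <- P2 <-; rewrite ?rmorphD ?rmorphM. Qed.

Lemma eq_pev (S : comNzRingType) (phi phi' : R -> S) (e e' : V -> S)
    (P : pexp R V) :
  phi =1 phi' -> e =1 e' -> pev phi e P = pev phi' e' P.
Proof. by move=> Ephi Ee; elim: P => //= P1 -> P2 ->. Qed.

Lemma pev_subst (W : Type) (S : comNzRingType) (phi : R -> S) (e : W -> S)
    (s : V -> pexp R W) (P : pexp R V) :
  pev phi e (psubst s P) = pev phi (fun i => pev phi e (s i)) P.
Proof. by elim: P => //= P1 -> P2 ->. Qed.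

End PexpAlgebra.

Section Hadamard.
Variables (R : comNzRingType) (V : eqType) (i : V).

Lemma pev_var_quo (S : comNzRingType) (phi : {rmorphism R -> S}) (e : V -> S)
    (P : pexp R V) :
  pev phi e P =
  pev phi (fun j => if j == i then 0 else e j) P + e i * pev phi e (var_quo i P).
Proof.
elim: P => [c|j|P1 E1 P2 E2|P1 E1 P2 E2] /=.
- by rewrite rmorph0 mulr0 addr0.
- case: eqP => [->|_]; first by rewrite rmorph1 add0r mulr1.
  by rewrite rmorph0 mulr0 addr0.
- by rewrite E1 E2; ring.
- rewrite pev_subst.
  rewrite (@eq_pev _ _ _ phi phi (fun j => pev phi e (if j == i then PC 0 else PX j))
    (fun j => if j == i then 0 else e j)) //; last first.
    by move=> j; case: eqP => //= _; rewrite rmorph0.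
  set a := pev phi (fun j => _) P1 in E1 *.
  set b := pev phi (fun j => _) P2 in E2 *.
  by rewrite {1}E1 {1}E2 E2; ring.
Qed.

End Hadamard.

Definition is_pexp (R : comNzRingType) (V : Type) (f : (V -> R) -> R) :=
  exists P : pexp R V, forall e, f e = ev e P.

Section IsPexp.
Variables (R : comNzRingType) (V : Type).
Implicit Types f g : (V -> R) -> R.

Lemma is_pexpC (c : R) : is_pexp (fun _ : V -> R => c).
Proof. by exists (PC c). Qed.

Lemma is_pexpX (i : V) : is_pexp (fun e : V -> R => e i).
Proof. by exists (PX i). Qed.

Lemma is_pexpM f g : is_pexp f -> is_pexp g -> is_pexp (fun e => f e * g e).
Proof. by move=> [P HP] [Q HQ]; exists (PM P Q) => e /=; rewrite HP HQ. Qed.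

Lemma is_pexp_sqr f : is_pexp f -> is_pexp (fun e => f e ^+ 2).
Proof. by move=> Hf; exact: (is_pexpM Hf Hf). Qed.

Lemma is_pexp_ev (W : Type) (P : pexp R W) (s : W -> V) :
  is_pexp (fun e => ev (fun i => e (s i)) P).
Proof. by exists (psubst (fun i => PX (s i)) P) => e; rewrite pev_subst. Qed.

Lemma is_pexp_sum (I : Type) (s : seq I) (F : I -> (V -> R) -> R) :
  (forall i, is_pexp (F i)) -> is_pexp (fun e => \sum_(i <- s) F i e).
Proof.
move=> HF; elim: s => [|i s [P HP]].
  by exists (PC 0) => e; rewrite big_nil.
have [Q HQ] := HF i.
by exists (PA Q P) => e; rewrite big_cons HQ HP.
Qed.

Lemma is_pexp_prod (I : Type) (s : seq I) (F : I -> (V -> R) -> R) :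
  (forall i, is_pexp (F i)) -> is_pexp (fun e => \prod_(i <- s) F i e).
Proof.
move=> HF; elim: s => [|i s [P HP]].
  by exists (PC 1) => e; rewrite big_nil.
have [Q HQ] := HF i.
by exists (PM Q P) => e; rewrite big_cons HQ HP.
Qed.

End IsPexp.

Lemma meval_is_pexp (R : comNzRingType) (n : nat) (p : mpoly.mpoly n R) :
  is_pexp (fun e => mpoly.meval e p).
Proof.
pose F (m : mpoly.multinom n) (e : 'I_n -> R) : R :=
  mpoly.mcoeff m p * \prod_(i <- index_enum 'I_n)
    \prod_(k <- iota 0 (mpoly.fun_of_multinom m i)) e i.
have [|P HP] := @is_pexp_sum R 'I_n _ (mpoly.msupp p) F.
  move=> m.
  have [|P HP] := @is_pexp_prod R 'I_n _ (index_enum 'I_n)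
    (fun i e => \prod_(k <- iota 0 (mpoly.fun_of_multinom m i)) e i).
    by move=> i; apply: is_pexp_prod => k; exists (PX i).
  by exists (PM (PC (mpoly.mcoeff m p)) P) => e; rewrite /F HP.
exists P => e; rewrite -HP mpoly.mevalE; apply: eq_bigr => m _.
congr (_ * _); apply: eq_bigr => i _.
by rewrite big_const_seq count_predT size_iota -Monoid.iteropE.
Qed.

(** * Definable predicates and quantifier elimination *)

Section Definable.
Variable R : rcfType.
Implicit Types P Q : (nat -> R) -> Prop.

(** Only finitely supported valuations matter, since a formula is evaluated at
    the default-extended sequence [nth 0 e]. *)
Definition definable P :=
  exists f : ordered_qelim.ord.formula R,
    forall e : seq R, P (nth 0 e) <-> ordered_qelim.ord.holds e f.

Definition upd (T : Type) (e : nat -> T) (i : nat) (x : T) (j : nat) : T :=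
  if j == i then x else e j.

Lemma nth_set_nth_upd (e : seq R) i x : nth 0 (set_nth 0 e i x) = upd (nth 0 e) i x.
Proof. by apply/funext => j; rewrite nth_set_nth. Qed.

Lemma definable_ext P Q : (forall e, P e <-> Q e) -> definable P -> definable Q.
Proof. by move=> PQ [f Hf]; exists f => e; rewrite -PQ. Qed.

Lemma definable_and P Q : definable P -> definable Q ->
  definable (fun e => P e /\ Q e).
Proof.
by move=> [f Hf] [g Hg]; exists (ordered_qelim.ord.And f g) => e /=; rewrite Hf Hg.
Qed.

Lemma definable_not P : definable P -> definable (fun e => ~ P e).
Proof. by move=> [f Hf]; exists (ordered_qelim.ord.Not f) => e /=; rewrite Hf. Qed.

Lemma definable_ex P i : definable P -> definable (fun e => exists x, P (upd e i x)).
Proof.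
move=> [f Hf]; exists (ordered_qelim.ord.Exists i f) => e /=.
by split=> -[x Hx]; exists x; move: Hx; rewrite -nth_set_nth_upd Hf.
Qed.

Fixpoint term_of_pexp (P : pexp R nat) : GRing.term R :=
  match P with
  | PC c => GRing.Const c
  | PX i => GRing.Var _ i
  | PA P1 P2 => GRing.Add (term_of_pexp P1) (term_of_pexp P2)
  | PM P1 P2 => GRing.Mul (term_of_pexp P1) (term_of_pexp P2)
  end.

Lemma eval_term_of_pexp e (P : pexp R nat) :
  GRing.eval e (term_of_pexp P) = ev (nth 0 e) P.
Proof. by elim: P => //= P1 -> P2 ->. Qed.

Lemma definable_eq (f g : (nat -> R) -> R) : is_pexp f -> is_pexp g ->
  definable (fun e => f e = g e).
Proof.
move=> [P HP] [Q HQ].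
exists (ordered_qelim.ord.Equal (term_of_pexp P) (term_of_pexp Q)) => e /=.
by rewrite !eval_term_of_pexp HP HQ.
Qed.

Lemma definable_lt (f g : (nat -> R) -> R) : is_pexp f -> is_pexp g ->
  definable (fun e => f e < g e).
Proof.
move=> [P HP] [Q HQ].
exists (ordered_qelim.ord.Lt (term_of_pexp P) (term_of_pexp Q)) => e /=.
by rewrite !eval_term_of_pexp HP HQ.
Qed.

Lemma definable_le (f g : (nat -> R) -> R) : is_pexp f -> is_pexp g ->
  definable (fun e => f e <= g e).
Proof.
move=> [P HP] [Q HQ].
exists (ordered_qelim.ord.Le (term_of_pexp P) (term_of_pexp Q)) => e /=.
by rewrite !eval_term_of_pexp HP HQ.
Qed.

(** Quantification over a block of [k] consecutive variables. *)
Lemma definable_ex_block P a k : definable P ->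
  definable (fun e => exists e',
    (forall j, ~~ (a <= j < a + k)%N -> e' j = e j) /\ P e').
Proof.
move=> dP; elim: k => [|k IH].
  apply: definable_ext dP => e; split.
    by move=> Pe; exists e.
  move=> [e' [He' Pe']]; suff -> : e = e' by [].
  by apply/funext => j; rewrite He' // addn0; lia.
apply: definable_ext (definable_ex (a + k) IH) => e; split.
  move=> [x [e' [He' Pe']]]; exists e'; split=> // j Hj.
  rewrite He' /upd; last by lia.
  by case: eqP => // Ej; lia.
move=> [e' [He' Pe']]; exists (e' (a + k)%N), e'; split=> // j Hj.
rewrite /upd; case: eqP => [->//|Ej]; apply: He'; lia.
Qed.

(** Faithful on terms without inverse only, see [ev_pexp_of_term]. *)
Fixpoint pexp_of_term (t : GRing.term R) : pexp R nat :=
  match t with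
  | GRing.Var i => PX i
  | GRing.Const c => PC c
  | GRing.NatConst n => PC n%:R
  | GRing.Add t1 t2 => PA (pexp_of_term t1) (pexp_of_term t2)
  | GRing.Opp t1 => PM (PC (-1)) (pexp_of_term t1)
  | GRing.NatMul t1 n => PM (PC n%:R) (pexp_of_term t1)
  | GRing.Mul t1 t2 => PM (pexp_of_term t1) (pexp_of_term t2)
  | GRing.Inv _ => PC 0
  | GRing.Exp t1 n => iter n (PM (pexp_of_term t1)) (PC 1)
  end.

Lemma ev_pexp_of_term e t : GRing.rterm t ->
  ev (nth 0 e) (pexp_of_term t) = GRing.eval e t.
Proof.
elim: t => //=.
- by move=> t1 IH1 t2 IH2 /andP[/IH1-> /IH2->].
- by move=> t /[apply] ->; rewrite mulN1r.
- by move=> t IH n /IH->; rewrite mulr_natl.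
- by move=> t1 IH1 t2 IH2 /andP[/IH1-> /IH2->].
- move=> t IH n /IH <-; elim: n => [|n IHn] /=; first by rewrite expr0.
  by rewrite IHn exprS.
Qed.

Definition same_signs (L : seq (pexp R nat)) (e e' : seq R) :=
  forall F, List.In F L -> Num.sg (ev (nth 0 e) F) = Num.sg (ev (nth 0 e') F).

Lemma qf_sign_determined (f : ordered_qelim.ord.formula R) :
  ordered_qelim.ord.qf_form f -> ordered_qelim.ord.rformula f ->
  exists L, forall e e', same_signs L e e' ->
    ordered_qelim.ord.qf_eval e f = ordered_qelim.ord.qf_eval e' f.
Proof.
pose D t1 t2 := PA (pexp_of_term t1) (PM (PC (-1)) (pexp_of_term t2)).
have HD e t1 t2 : GRing.rterm t1 -> GRing.rterm t2 ->
    ev (nth 0 e) (D t1 t2) = GRing.eval e t1 - GRing.eval e t2.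
  by move=> r1 r2; rewrite /= !ev_pexp_of_term // mulN1r.
have connective f1 f2 (b : bool -> bool -> bool)
    (qf := @ordered_qelim.ord.qf_eval R) :
    (exists L, forall e e', same_signs L e e' -> qf e f1 = qf e' f1) ->
    (exists L, forall e e', same_signs L e e' -> qf e f2 = qf e' f2) ->
    exists L, forall e e', same_signs L e e' ->
      b (qf e f1) (qf e f2) = b (qf e' f1) (qf e' f2).
  move=> [L1 H1] [L2 H2]; exists (L1 ++ L2) => e e' H.
  rewrite (H1 e e') ?(H2 e e') // => F HF; apply: H; apply/List.in_app_iff; tauto.
elim: f => //=.
- by move=> b _ _; exists [::].
- move=> t1 t2 _ /andP[r1 r2]; exists [:: D t1 t2] => e e' /(_ _ (or_introl erefl)).
  by rewrite !HD // -subr_eq0 -sgr_eq0 => ->; rewrite sgr_eq0 subr_eq0.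
- move=> t1 t2 _ /andP[r1 r2]; exists [:: D t2 t1] => e e' /(_ _ (or_introl erefl)).
  by rewrite !HD // -subr_gt0 -sgr_gt0 => ->; rewrite sgr_gt0 subr_gt0.
- move=> t1 t2 _ /andP[r1 r2]; exists [:: D t2 t1] => e e' /(_ _ (or_introl erefl)).
  by rewrite !HD // -subr_ge0 -sgr_ge0 => ->; rewrite sgr_ge0 subr_ge0.
- move=> f1 IH1 f2 IH2 /andP[q1 q2] /andP[r1 r2].
  by apply: connective; [exact: IH1|exact: IH2].
- move=> f1 IH1 f2 IH2 /andP[q1 q2] /andP[r1 r2].
  by apply: connective; [exact: IH1|exact: IH2].
- move=> f1 IH1 f2 IH2 /andP[q1 q2] /andP[r1 r2].
  by apply: (connective _ _ implb); [exact: IH1|exact: IH2].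
- by move=> f IH qf rf; have [L HL] := IH qf rf; exists L => e e' /HL ->.
Qed.

(** Quantifier elimination over real closed fields (Tarski), in the only form
    used below: whether a definable predicate holds depends on nothing but the
    signs of finitely many polynomials. *)
Theorem sign_determined P : definable P ->
  exists L, forall e e', same_signs L e e' -> P (nth 0 e) -> P (nth 0 e').
Proof.
move=> [f Hf].
pose g := ordered_qelim.ord.quantifier_elim
  (fun n s => qe_rcf.qfr_to_formula (@qe_rcf.wproj R n s))
  (ordered_qelim.ord.to_rform f).
have rf := ordered_qelim.ord.to_rform_rformula f.
have /andP[qg rg] :=
  ordered_qelim.ord.quantifier_elim_wf (@qe_rcf.wf_QE_wproj R) rf.
have [L HL] := qf_sign_determined qg rg.
have Pg e : P (nth 0 e) <-> ordered_qelim.ord.qf_eval e g.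
  by rewrite Hf; exact: (rwP (qe_rcf.rcf_satP e f)).
by exists L => e e' /HL Eg; rewrite !Pg -/g Eg.
Qed.

End Definable.

(** * Definable sets of the line and of the plane *)

(** From here on the variables 0, 1 and 2 are called [s], [w] and [c]. *)
Section OneVariable.
Variable R : rcfType.
Implicit Types (p : {poly R}) (L : seq (pexp R nat)).

Lemma root_between_signs p a b : a <= b -> Num.sg p.[a] != Num.sg p.[b] ->
  exists2 x, a <= x <= b & p.[x] = 0.
Proof.
move=> ab neq.
have [pa0|pa0] := eqVneq p.[a] 0; first by exists a; rewrite ?lexx.
have [pb0|pb0] := eqVneq p.[b] 0; first by exists b; rewrite ?lexx ?ab.
have [|x] := @ivt_sign R p a b ab.
  by move: neq; case: (sgrP p.[a]) pa0 => // _ _;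
     case: (sgrP p.[b]) pb0 => // _ _; rewrite ?eqxx // ?mulr1 ?mul1r.
by rewrite in_itv => /andP[ax xb] /rootP px; exists x => //; rewrite !ltW.
Qed.

Definition upoly (F : pexp R nat) (w c : R) : {poly R} :=
  pev polyC (fun k => if k is k'.+1 then (nth 0 [:: w; c] k')%:P else 'X) F.

Lemma upolyE F w c s : (upoly F w c).[s] = ev (nth 0 [:: s; w; c]) F.
Proof.
rewrite -horner_evalE rmorph_pev; apply: eq_pev => [x|[|k]] /=.
- by rewrite horner_evalE hornerC.
- by rewrite horner_evalE hornerX.
- by rewrite horner_evalE hornerC.
Qed.

Lemma const_sign_right p : exists2 e, 0 < e &
  forall s s', 0 < s < e -> 0 < s' < e -> Num.sg p.[s] = Num.sg p.[s'].
Proof.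
have [->|p0] := eqVneq p 0; first by exists 1 => // s s' _ _; rewrite !horner0.
exists (next_root p 0 1); first exact: next_root_gt.
move=> s s' Hs Hs'.
by rewrite (@sgr_neighpr _ 1 p 0 s) ?(@sgr_neighpr _ 1 p 0 s').
Qed.

Lemma const_signs_right L w c : exists2 e, 0 < e &
  forall F, List.In F L -> forall s s', 0 < s < e -> 0 < s' < e ->
    Num.sg (upoly F w c).[s] = Num.sg (upoly F w c).[s'].
Proof.
elim: L => [|F L [e e0 He]]; first by exists 1.
have [e' e'0 He'] := const_sign_right (upoly F w c).
exists (Num.min e e') => [|G [<-|GL] s s']; rewrite ?lt_min ?e0 //.
- by move=> /and3P[s0 _ se] /and3P[s'0 _ s'e]; apply: He'; rewrite ?s0 ?s'0.
- by move=> /and3P[s0 se _] /and3P[s'0 s'e _]; apply: He; rewrite ?s0 ?s'0.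
Qed.

(** O-minimality at [0+]: the signs of finitely many polynomials are constant on
    some interval to the right of [0]. *)
Lemma definable_dichotomy (P : (nat -> R) -> Prop) (w c : R) : definable P ->
  (forall e, 0 < e -> exists2 s, 0 < s < e & P (nth 0 [:: s; w; c])) ->
  exists2 e, 0 < e & forall s, 0 < s < e -> P (nth 0 [:: s; w; c]).
Proof.
move=> /sign_determined[L HL] small.
have [e e0 He] := const_signs_right L w c.
exists e => // s Hs; have [s' Hs' Ps'] := small e e0.
by apply: HL Ps' => F FL; rewrite -!upolyE; apply: He.
Qed.

(** The half-open intervals between consecutive [s_ j] are disjoint, so [x] is in
    at most one of those closed on the left and one of those closed on the
    right. *)
Lemma count_crossings (s_ : nat -> R) (M : nat) (x : R) :
  (forall j, s_ j <= s_ j.+1) ->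
  (\sum_(j < M) ((s_ j <= x < s_ j.+1)%R + (s_ j < x <= s_ j.+1)%R) <= 2)%N.
Proof.
move=> inc; pose N M := ((s_ M <= x)%R + (s_ M < x)%R)%N.
suff : (\sum_(j < M) ((s_ j <= x < s_ j.+1)%R + (s_ j < x <= s_ j.+1)%R) + N M <= 2)%N.
  by apply: leq_trans; rewrite leq_addr.
elim: M => [|M IH].
  by rewrite big_ord0 /N; do 2 case: (_ x) => //; case: (_ <= _); case: (_ < _).
rewrite big_ord_recr /=; apply: leq_trans IH; rewrite -addnA leq_add2l /N.
have := inc M; move: (s_ M) (s_ M.+1) => a b ab.
by case: (leP a x); case: (leP b x); case: (ltgtP a x); case: (ltgtP b x) => //=;
  try lia; move=> *; exfalso; lra.
Qed.

(** Each sign change is witnessed by a root, and each root is shared by at most two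
    consecutive intervals. *)
Lemma sign_changes_le p (s_ : nat -> R) (M : nat) : (forall j, s_ j <= s_ j.+1) ->
  (\sum_(j < M) (Num.sg p.[s_ j] != Num.sg p.[s_ j.+1]) <= 2 * size p)%N.
Proof.
move=> inc; have [->|p0] := eqVneq p 0.
  by rewrite big1 // => j _; rewrite !horner0 eqxx.
apply: (@leq_trans (\sum_(x <- rootsR p) 2)%N); last first.
  rewrite big_const_seq iter_addn_0 count_predT leq_mul2l /=.
  apply: ltnW; apply: max_poly_roots => //; last exact: uniq_roots.
  by apply/allP => x; rewrite -(roots_on_rootsR p0) => /andP[].
apply: (@leq_trans (\sum_(x <- rootsR p)
    \sum_(j < M) ((s_ j <= x < s_ j.+1)%R + (s_ j < x <= s_ j.+1)%R))%N); last first.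
  by apply: leq_sum => x _; apply: count_crossings.
rewrite exchange_big /=; apply: leq_sum => j _.
case: (boolP (_ != _)) => //= neq.
have [x /andP[ax xb] px] := root_between_signs (inc j) neq.
have xr : x \in rootsR p by rewrite -(roots_on_rootsR p0) in_itv; apply/rootP.
rewrite (big_rem x xr) /=; apply: leq_trans (leq_addr _ _).
have : s_ j != s_ j.+1 by apply: contraNneq neq => ->.
rewrite ax xb => ab; have [//|bx] := ltP x (s_ j.+1).
by rewrite (lt_le_trans _ bx) // lt_neqAle ab inc.
Qed.

End OneVariable.

Section TwoVariables.
Variable R : rcfType.
Implicit Types (F : pexp R nat) (L : seq (pexp R nat)).

(** Freezing [c] cannot raise the degree in [s] of a polynomial in [s] and [c];
    this makes the bound of [definable_changes_le] uniform in [c]. *)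
Lemma size_upoly_le F w : exists d, forall c, (size (upoly F w c) <= d)%N.
Proof.
pose bp : {poly {poly R}} := pev (fun x => x%:P%:P)
  (fun k => nth 0 [:: 'X; w%:P%:P; 'X%:P] k) F.
exists (size bp) => c.
suff -> : upoly F w c = map_poly (horner_eval c) bp by rewrite /map_poly size_poly.
rewrite rmorph_pev; apply: eq_pev => [x|[|[|[|k]]]] /=.
- by rewrite map_polyC /= horner_evalE hornerC.
- by rewrite map_polyX.
- by rewrite map_polyC /= horner_evalE hornerC.
- by rewrite map_polyC /= horner_evalE hornerX.
- by rewrite !nth_nil !rmorph0.
Qed.

Lemma size_upolys_le L w : exists d, forall c,
  (\sum_(F <- L) 2 * size (upoly F w c) <= d)%N.
Proof.
elim: L => [|F L [d Hd]]; first by exists 0%N => c; rewrite big_nil.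
have [d' Hd'] := size_upoly_le F w; exists (2 * d' + d)%N => c.
by rewrite big_cons leq_add // leq_mul2l Hd'.
Qed.

Lemma sum_sign_changes_ge1 L w c s s' :
  (exists2 F, List.In F L & Num.sg (upoly F w c).[s] != Num.sg (upoly F w c).[s']) ->
  (1 <= \sum_(F <- L) (Num.sg (upoly F w c).[s] != Num.sg (upoly F w c).[s']))%N.
Proof.
elim: L => [|G L IH] [F]; first by [].
case=> [<-|FL] neq; rewrite big_cons.
  by rewrite neq.
by apply: (leq_trans _ (leq_addl _ _)); apply: IH; exists F.
Qed.

(** Uniform finiteness: the lines [c = constant] meet the boundary of a definable
    set of pairs [(s, c)] a bounded number of times. *)
Lemma definable_changes_le (P : (nat -> R) -> Prop) (w : R) : definable P ->
  exists K, forall (c : R) (s_ : nat -> R) (M : nat), (forall j, s_ j <= s_ j.+1) ->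
    (\sum_(j < M) (`[< P (nth 0%R [:: s_ j; w; c]) >]
                   != `[< P (nth 0%R [:: s_ j.+1; w; c]) >]) <= K)%N.
Proof.
move=> /sign_determined[L HL].
have [K HK] := size_upolys_le L w; exists K => c s_ M inc.
apply: leq_trans (HK c).
apply: (@leq_trans (\sum_(F <- L) \sum_(j < M)
  (Num.sg (upoly F w c).[s_ j] != Num.sg (upoly F w c).[s_ j.+1]))%N); last first.
  by apply: leq_sum => F _; apply: sign_changes_le.
rewrite exchange_big /=; apply: leq_sum => j _.
case: (boolP (_ != _)) => //= neq; apply: sum_sign_changes_ge1.
apply: contrapT => nex; move/eqP: neq; apply.
have same F : List.In F L ->
    Num.sg (upoly F w c).[s_ j] = Num.sg (upoly F w c).[s_ j.+1].
  by move=> FL; apply/eqP/negP => /negP neq; apply: nex; exists F.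
by apply: asbool_equiv_eq; split; apply: HL => F /same; rewrite !upolyE.
Qed.

Lemma poly_bound1 (p : {poly R}) : exists C, forall w, `|w| <= 1 -> `|p.[w]| <= C.
Proof.
elim/poly_ind: p => [|p c [C HC]]; first by exists 0 => w _; rewrite horner0 normr0.
exists (C + `|c|) => w w1; rewrite hornerMXaddC.
rewrite (le_trans (ler_normD _ _)) // lerD2r normrM -[C]mulr1.
by apply: ler_pM => //; apply: HC.
Qed.

Lemma poly2_bound1 (p : {poly {poly R}}) : exists C, forall s w,
  `|s| <= 1 -> `|w| <= 1 -> `|(p.[s%:P]).[w]| <= C.
Proof.
elim/poly_ind: p => [|p c [C HC]].
  by exists 0 => s w _ _; rewrite !horner0 normr0.
have [B HB] := poly_bound1 c.
exists (C + B) => s w s1 w1; rewrite hornerMXaddC hornerD hornerM hornerC.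
rewrite (le_trans (ler_normD _ _)) // lerD ?HB // normrM -[C]mulr1.
by apply: ler_pM => //; apply: HC.
Qed.

Lemma factor_X (S : idomainType) (p : {poly S}) : p != 0 ->
  exists k q, q.[0] != 0 /\ p = q * 'X^k.
Proof.
move=> p0; have [k [q]] := multiplicity_XsubC p 0.
by rewrite p0 /= subr0 => nr ->; exists k, q.
Qed.

(** An elementary substitute for Puiseux expansions: dividing [p] by the largest
    power of [s] leaves [q] with [q (0, w) = w ^+ j * b w] and [b 0 != 0], while
    [q (s, w)] and [q (0, w)] differ by at most [C * s]. Hence a zero [(s, w)]
    with [w] small satisfies [w ^+ j * |b 0| / 2 <= C * s]. *)
Lemma curve_branch_bound (p : {poly {poly R}}) :
  exists eta j C, [/\ 0 < eta, eta <= 1 & forall s w, 0 < s -> s <= 1 ->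
    0 <= w -> w <= eta -> p.[s%:P] != 0 -> (p.[s%:P]).[w] = 0 -> w ^+ j <= C * s].
Proof.
have [->|p0] := eqVneq p 0.
  by exists 1, 0%N, 0; split=> // s w _ _ _ _; rewrite horner0 eqxx.
have [k [q [q0 ->]]] := factor_X p0.
have [j [b [b0 Eb]]] := factor_X q0.
(* [r] measures the variation of [q] away from [s = 0], and [r'] that of [b]. *)
have [r Er] : exists r, q = q.[0]%:P + r * 'X.
  have /factor_theorem[r Er] : root (q - q.[0]%:P) 0.
    by rewrite /root hornerD hornerN hornerC subrr.
  by exists r; move/eqP: Er; rewrite subr0 subr_eq addrC => /eqP.
have [C HC] := poly2_bound1 r.
have [r' Er'] : exists r', b = b.[0]%:P + r' * 'X.
  have /factor_theorem[r' Er'] : root (b - b.[0]%:P) 0.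
    by rewrite /root hornerD hornerN hornerC subrr.
  by exists r'; move/eqP: Er'; rewrite subr0 subr_eq addrC => /eqP.
have [B HB] := poly_bound1 r'.
have B0 : 0 <= B by apply: le_trans (HB 0 _); rewrite ?normr0.
pose a := `|b.[0]| / 2.
have a0 : 0 < a by rewrite divr_gt0 ?normr_gt0.
(* For [w <= eta] the value [b w] stays within [a = |b 0| / 2] of [b 0]. *)
pose eta := Num.min 1 (a / (B + 1)).
exists eta, j, (C / a); split=> [||s w s0 s1 w0 we _].
- by rewrite lt_min ltr01 divr_gt0 // ltr_wpDl.
- by rewrite ge_min lexx.
rewrite hornerM hornerXn hornerM -rmorphXn /= hornerC => /eqP.
rewrite mulf_eq0 (gt_eqF (exprn_gt0 _ s0)) orbF => /eqP.
have w1 : w <= 1 by apply: le_trans we _; rewrite ge_min lexx.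
have n1 x : 0 <= x -> x <= 1 -> `|x| <= 1 by move=> x0 ?; rewrite ger0_norm.
rewrite Er hornerD hornerMX hornerC hornerD hornerM hornerC Eb hornerM hornerXn => /eqP.
rewrite addrC addr_eq0 => /eqP E.
have bw : a <= `|b.[w]|.
  rewrite Er' hornerD hornerC hornerMX.
  have : `|r'.[w] * w| <= a.
    rewrite normrM (ger0_norm w0).
    have wB : w * (B + 1) <= a.
      rewrite -ler_pdivlMr ?ltr_wpDl //.
      by apply: le_trans we _; rewrite ge_min lexx orbT.
    apply: le_trans wB; rewrite mulrC ler_wpM2l //.
    by apply: le_trans (HB w _) _; rewrite ?n1 // lerDl.
  have := lerB_normD (b.[0]) (r'.[w] * w).
  have : `|b.[0]| = a + a by rewrite /a -splitr.
  by move=> ->; lra.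
rewrite mulrAC ler_pdivlMr //.
have : w ^+ j * a <= `|b.[w] * w ^+ j|.
  by rewrite normrM mulrC (ger0_norm (exprn_ge0 _ w0)) ler_wpM2r // exprn_ge0.
move/le_trans; apply; rewrite -normrN -E normrM (gtr0_norm s0).
by apply: ler_wpM2r; [exact: ltW | apply: HC; apply: n1 => //; exact: ltW].
Qed.

End TwoVariables.

Section Consequences.
Variable R : rcfType.
Implicit Types (F : pexp R nat) (L : seq (pexp R nat)).

Lemma sign_change_power_bound F (c : R) :
  exists eta j C, [/\ 0 < eta, eta <= 1, 0 <= C & forall eta' s w,
    0 < s <= 1 -> 0 <= w <= eta' -> eta' <= eta ->
    Num.sg (ev (nth 0 [:: s; w; c]) F) != Num.sg (ev (nth 0 [:: s; eta'; c]) F) ->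
    w ^+ j <= C * s].
Proof.
pose p : {poly {poly R}} := pev (fun x => x%:P%:P)
  (fun k => nth 0 [:: 'X; 'X%:P; c%:P%:P] k) F.
have pE s w : (p.[s%:P]).[w] = ev (nth 0 [:: s; w; c]) F.
  rewrite -2!horner_evalE !rmorph_pev.
  apply: eq_pev => [x|[|[|[|k]]]] /=; rewrite !horner_evalE ?hornerE //.
  by rewrite !nth_nil !horner0.
have [eta [j [C [eta0 eta1 H]]]] := curve_branch_bound p.
exists eta, j, `|C|; split=> // eta' s w /andP[s0 s1] /andP[w0 we] ee.
rewrite -!pE => neq.
have [x /andP[wx xe] px] := root_between_signs we neq.
have pn0 : p.[s%:P] != 0 by apply: contraNneq neq => ->; rewrite !horner0.
have x0 := le_trans w0 wx.
apply: (@le_trans _ _ (x ^+ j)); first exact: lerXn2r.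
apply: le_trans (H s x s0 s1 x0 (le_trans xe ee) pn0 px) _.
by rewrite ler_wpM2r ?ler_norm // ltW.
Qed.

Lemma sign_changes_power_bound L (c : R) :
  exists eta j C, [/\ 0 < eta, eta <= 1, 0 <= C & forall F, List.In F L ->
    forall eta' s w, 0 < s <= 1 -> 0 <= w <= eta' -> eta' <= eta ->
    Num.sg (ev (nth 0 [:: s; w; c]) F) != Num.sg (ev (nth 0 [:: s; eta'; c]) F) ->
    w ^+ j <= C * s].
Proof.
elim: L => [|F L [eta [j [C [e0 e1 C0 H]]]]]; first by exists 1, 0%N, 0.
have [eta' [j' [C' [e'0 e'1 C'0 H']]]] := sign_change_power_bound F c.
exists (Num.min eta eta'), (maxn j j'), (Num.max C C').
split; rewrite ?lt_min ?e0 ?le_max ?C0 ?ge_min ?e1 //.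
move=> G GL d s w s1 wd; rewrite le_min => /andP[de de'] neq.
have /andP[s0 _] := s1; have /andP[w0 wd'] := wd.
have w1 : w <= 1 by apply: le_trans wd' (le_trans de e1).
have pow k : (k <= maxn j j')%N -> w ^+ maxn j j' <= w ^+ k.
  by move=> kj; apply: ler_wiXn2l.
case: GL neq => [<-|GL] neq.
  apply: (le_trans (pow j' _)); first by rewrite leq_maxr.
  apply: le_trans (H' d s w s1 wd de' neq) _.
  by rewrite ler_pM2r // le_max lexx orbT.
apply: (le_trans (pow j _)); first by rewrite leq_maxl.
apply: le_trans (H G GL d s w s1 wd de neq) _.
by rewrite ler_pM2r // le_max lexx.
Qed.

(** Between a point [w] inside a definable set and the point [eta] outside it, one
    of the defining polynomials has a root; by [curve_branch_bound] that root,
    and a fortiori [w], is bounded by a power of [s]. *)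
Lemma definable_power_bound (P : (nat -> R) -> Prop) (c : R) : definable P ->
  exists eta j C, [/\ 0 < eta, eta <= 1, 0 <= C & forall s w,
    0 < s <= 1 -> 0 <= w <= eta ->
    P (nth 0 [:: s; w; c]) -> ~ P (nth 0 [:: s; eta; c]) -> w ^+ j <= C * s].
Proof.
move=> /sign_determined[L HL].
have [eta [j [C [e0 e1 C0 H]]]] := sign_changes_power_bound L c.
exists eta, j, C; split=> // s w s1 we Pw nP.
have [F FL neq] : exists2 F, List.In F L &
    Num.sg (ev (nth 0 [:: s; w; c]) F) != Num.sg (ev (nth 0 [:: s; eta; c]) F).
  apply: contrapT => nex; apply: nP; apply: HL Pw => F FL.
  by apply/eqP/negP => /negP neq; apply: nex; exists F.
exact: H FL _ _ _ s1 we _ neq.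
Qed.

(** Banach's indicatrix formula, for finite sequences: the variation is the
    integral over [c] of the number of crossings of the level [c]. The integral
    is a finite sum over the intervals between consecutive values [v i] of [y],
    on each of which the number of crossings is constant. *)
Lemma sum_dist_le_crossings (y : nat -> R) (r : R) (K M : nat) :
  (forall j, `|y j| <= r) ->
  (forall c, (\sum_(j < M) ((c < y j)%R != (c < y j.+1)%R) <= K)%N) ->
  \sum_(j < M) `|y j.+1 - y j| <= K%:R * (2 * r).
Proof.
move=> yr HK; pose vs := sort <=%R (undup [seq y j | j <- iota 0 M.+1]).
pose v i := nth 0 vs i; pose m := (size vs).-1.
have memv j : (j <= M)%N -> y j \in vs.
  by move=> jM; rewrite mem_sort mem_undup map_f // mem_iota add0n.
have vs0 : (0 < size vs)%N.
  by have := memv 0%N isT; case: (vs).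
have Em : m.+1 = size vs by rewrite /m prednK.
clearbody m.
have sv : sorted <%R vs by rewrite sort_lt_sorted undup_uniq.
have vlt i k : (i < k < size vs)%N -> v i < v k.
  move=> /andP[ik ks]; apply: (sorted_ltn_nth lt_trans) => //.
  by rewrite inE (ltn_trans ik).
have vstep i : (i < m)%N -> 0 <= v i.+1 - v i.
  by move=> im; rewrite subr_ge0 ltW // vlt // ltnSn /= -Em.
have vr i : (i < size vs)%N -> `|v i| <= r.
  move=> ivs; have : v i \in vs by rewrite mem_nth.
  by rewrite mem_sort mem_undup => /mapP[j _ ->].
pose b (a a' : R) i := ((v i < a)%R != (v i < a')%R).
have bC a a' i : b a a' i = b a' a i by rewrite /b eq_sym.
have step a a' : a \in vs -> a' \in vs ->
    `|a' - a| <= \sum_(i < m) (b a a' i)%:R * (v i.+1 - v i).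
  wlog aa : a a' / a <= a'.
    move=> H ma ma'; case/orP: (le_total a a') => aa; first exact: H.
    by rewrite distrC; under eq_bigr do rewrite bC; apply: H.
  move=> ma ma'; have [->|neq] := eqVneq a a'.
    rewrite subrr normr0 sumr_ge0 // => i _; by rewrite mulr_ge0 ?ler0n // vstep.
  have {neq aa} lta : a < a' by rewrite lt_neqAle neq.
  have Ea : v (index a vs) = a by rewrite /v nth_index.
  have Ea' : v (index a' vs) = a' by rewrite /v nth_index.
  have la : (index a vs < size vs)%N by rewrite index_mem.
  have la' : (index a' vs < size vs)%N by rewrite index_mem.
  move: (index a vs) (index a' vs) Ea Ea' la la' => p q Ea Ea' la la'.
  have pq : (p < q)%N.
    rewrite ltnNge; apply/negP => qp; move: lta; rewrite -Ea -Ea' ltNge => /negP; apply.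
    by move: qp; rewrite leq_eqVlt => /orP[/eqP->//|qp]; rewrite ltW // vlt // qp.
  have qm : (q <= m)%N by lia.
  rewrite ger0_norm ?subr_ge0 ?(ltW lta) // -Ea -Ea' -telescope_sumr; last exact: ltnW.
  rewrite -(big_mkord xpredT (fun i => (b (v p) (v q) i)%:R * (v i.+1 - v i))).
  have nn i : (i < m)%N -> 0 <= (b (v p) (v q) i)%:R * (v i.+1 - v i).
    by move=> im; rewrite mulr_ge0 ?ler0n // vstep.
  rewrite (@big_cat_nat _ _ _ p 0 m) //=; last by lia.
  rewrite (@big_cat_nat _ _ _ q p m) //=; last by lia.
  have -> : \sum_(p <= i < q) (b (v p) (v q) i)%:R * (v i.+1 - v i) =
            \sum_(p <= i < q) (v i.+1 - v i).
    apply: eq_big_nat => i /andP[pi iq].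
    rewrite /b (vlt i q) ?iq //= ltNge.
    have -> : v p <= v i.
      by move: pi; rewrite leq_eqVlt => /orP[/eqP->//|pi]; rewrite ltW // vlt // pi; lia.
    by rewrite mul1r.
  rewrite addrCA lerDl addr_ge0 //.
    by rewrite big_nat_cond sumr_ge0 // => i /andP[/andP[_ ip] _]; apply: nn; lia.
  by rewrite big_nat_cond sumr_ge0 // => i /andP[/andP[_ ip] _]; apply: nn.
apply: (@le_trans _ _ (\sum_(j < M) \sum_(i < m)
    (b (y j) (y j.+1) i)%:R * (v i.+1 - v i))).
  by apply: ler_sum => j _; apply: step; apply: memv; have := ltn_ord j; lia.
rewrite exchange_big /=.
apply: (@le_trans _ _ (\sum_(i < m) K%:R * (v i.+1 - v i))).
  apply: ler_sum => i _; rewrite -mulr_suml -natr_sum ler_wpM2r ?ler_nat ?HK //.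
  exact: vstep.
rewrite -mulr_sumr ler_wpM2l ?ler0n //.
rewrite -(big_mkord xpredT (fun i => v i.+1 - v i)) telescope_sumr //.
have := vr 0%N vs0; have : `|v m| <= r by apply: vr; lia.
by rewrite !ler_norml => /andP[_ h1] /andP[h2 _]; lra.
Qed.

End Consequences.

(** * Taylor expansion *)

Section Taylor.
Variables (R : realFieldType) (n : nat).
Implicit Types (P : pexp R 'I_n) (e : 'I_n -> R).

Lemma ev_bound P r : exists2 B, 0 <= B &
  forall e, (forall i, `|e i| <= r) -> `|ev e P| <= B.
Proof.
elim: P => [c|i|P [B B0 HB] Q [C C0 HC]|P [B B0 HB] Q [C C0 HC]] /=.
- by exists `|c|.
- exists `|r| => // e He; apply: le_trans (He i) (ler_norm _).
- exists (B + C) => [|e He]; first exact: addr_ge0.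
  by apply: le_trans (ler_normD _ _) _; rewrite lerD ?HB ?HC.
- exists (B * C) => [|e He]; first exact: mulr_ge0.
  by rewrite normrM; apply: ler_pM => //; [exact: HB|exact: HC].
Qed.

Lemma ev_lipschitz P r : exists2 K, 0 <= K &
  forall e e', (forall i, `|e i| <= r) -> (forall i, `|e' i| <= r) ->
  `|ev e' P - ev e P| <= K * \sum_i `|e' i - e i|.
Proof.
have d0 e e' : 0 <= \sum_i `|e' i - e i| by rewrite sumr_ge0.
elim: P => [c|i|P [K K0 HK] Q [L L0 HL]|P [K K0 HK] Q [L L0 HL]] /=.
- by exists 0 => // e e' _ _; rewrite subrr normr0 mul0r.
- by exists 1 => // e e' _ _; rewrite mul1r (bigD1 i) //= lerDl sumr_ge0.
- exists (K + L) => [|e e' He He']; first exact: addr_ge0.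
  have -> : ev e' P + ev e' Q - (ev e P + ev e Q) =
    (ev e' P - ev e P) + (ev e' Q - ev e Q) by ring.
  by apply: le_trans (ler_normD _ _) _; rewrite [leRHS]mulrDl lerD ?HK ?HL.
- have [B B0 HB] := ev_bound P r; have [C C0 HC] := ev_bound Q r.
  exists (K * C + B * L) => [|e e' He He']; first by rewrite addr_ge0 ?mulr_ge0.
  have -> : ev e' P * ev e' Q - ev e P * ev e Q =
    (ev e' P - ev e P) * ev e' Q + ev e P * (ev e' Q - ev e Q) by ring.
  apply: le_trans (ler_normD _ _) _; rewrite [leRHS]mulrDl lerD // normrM.
    by rewrite mulrAC ler_pM ?HK ?HC.
  by rewrite -mulrA ler_pM ?HB ?HL.
Qed.

(** Stated for arbitrary points of a box rather than nearby ones: the definable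
    curves to which it is applied may jump. *)
Lemma ev_taylor P r : exists2 M, 0 <= M &
  forall e e', (forall i, `|e i| <= r) -> (forall i, `|e' i| <= r) ->
  `|ev e' P - ev e P - \sum_i ev e (pd i P) * (e' i - e i)|
    <= M * (\sum_i `|e' i - e i|) ^+ 2.
Proof.
elim: P => [c|j|P [M M0 HM] Q [L L0 HL]|P [M M0 HM] Q [L L0 HL]] /=.
- exists 0 => // e e' _ _; rewrite subrr big1 ?subrr ?normr0 ?mul0r // => i _.
  by rewrite mul0r.
- exists 0 => // e e' _ _; rewrite (bigD1 j) //= eqxx mul1r big1 ?addr0.
    by rewrite subrr normr0 mul0r.
  by move=> i /negbTE ij; rewrite eq_sym ij mul0r.
- exists (M + L) => [|e e' He He']; first exact: addr_ge0.
  under eq_bigr do rewrite mulrDl.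
  rewrite big_split /=.
  set dP := \sum_i _; set dQ := \sum_i _.
  have -> : ev e' P + ev e' Q - (ev e P + ev e Q) - (dP + dQ) =
    (ev e' P - ev e P - dP) + (ev e' Q - ev e Q - dQ) by ring.
  by apply: le_trans (ler_normD _ _) _; rewrite [leRHS]mulrDl lerD ?HM ?HL.
- have [B B0 HB] := ev_bound P r; have [C C0 HC] := ev_bound Q r.
  have [K K0 HK] := ev_lipschitz P r; have [J J0 HJ] := ev_lipschitz Q r.
  exists (K * J + M * C + B * L) => [|e e' He He'].
    by rewrite !addr_ge0 ?mulr_ge0.
  have -> : \sum_i (ev e (pd i P) * ev e Q + ev e P * ev e (pd i Q)) * (e' i - e i) =
     (\sum_i ev e (pd i P) * (e' i - e i)) * ev e Q +
     ev e P * (\sum_i ev e (pd i Q) * (e' i - e i)).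
    by rewrite mulr_suml mulr_sumr -big_split /=; apply: eq_bigr => i _; ring.
  set dP := \sum_i _ * _; set dQ := \sum_i _ * _.
  set d := \sum_i `|_|.
  have -> : ev e' P * ev e' Q - ev e P * ev e Q - (dP * ev e Q + ev e P * dQ) =
    (ev e' P - ev e P) * (ev e' Q - ev e Q) + (ev e' P - ev e P - dP) * ev e Q
     + ev e P * (ev e' Q - ev e Q - dQ) by ring.
  apply: le_trans (ler_normD _ _) _; rewrite [leRHS]mulrDl lerD //.
    apply: le_trans (ler_normD _ _) _; rewrite [leRHS]mulrDl lerD // normrM.
      by rewrite expr2 mulrACA ler_pM ?HK ?HJ.
    by rewrite mulrAC ler_pM ?HM ?HC.
  by rewrite normrM -mulrA ler_pM ?HB ?HL.
Qed.

End Taylor.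

(** * Definable choice *)

Section Blocks.
Variables (R : rcfType) (n : nat).

(** The [n] variables after [s], [w] and [c] are the coordinates of a point. *)
Definition point_of (e : nat -> R) : 'rV[R]_n := \row_(i < n) e (3 + i)%N.

Definition definable_family (Q : R -> R -> 'rV[R]_n -> Prop) :=
  definable (fun e => Q (e 0%N) (e 1%N) (point_of e)).

Lemma definable_ex_point (Q : R -> R -> R -> 'rV[R]_n -> Prop) :
  definable (fun e => Q (e 0%N) (e 1%N) (e 2%N) (point_of e)) ->
  definable (fun e => exists z, Q (e 0%N) (e 1%N) (e 2%N) z).
Proof.
move=> /(definable_ex_block 3 n); apply: definable_ext => e; split.
  by move=> [e' [He Qe']]; exists (point_of e'); rewrite -!He.
move=> [z Qz]; pose e' j := if insub (j - 3)%N is Some i then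
  if (3 <= j)%N then z 0 i else e j else e j.
exists e'; split=> [j Hj|].
  by rewrite /e'; case: insubP => // i Hi _; case: ifP => // j3; lia.
suff <- : z = point_of e'.
  by rewrite /e' /=; do 3 (case: insubP => //).
apply/rowP => i; rewrite mxE /e' leq_addr; case: insubP => [k _ Ek|].
  by congr (z 0 _); apply: val_inj; rewrite /= Ek addKn.
by rewrite addKn ltn_ord.
Qed.

Definition least_coord (i : 'I_n) (Q : R -> R -> 'rV[R]_n -> Prop) s w z :=
  Q s w z /\ forall z', Q s w z' -> z 0 i <= z' 0 i.

(** To compare the coordinates of two points with a single block of point
    variables, the coordinate of the first one is saved in the variable [c]
    before the block is quantified again. *)
Lemma definable_least_coord i Q : definable_family Q ->
  definable_family (least_coord i Q).
Proof.
move=> dQ.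
have dlt : definable (fun e => exists z, Q (e 0%N) (e 1%N) z /\ z 0 i < e 2%N).
  apply: (@definable_ex_point (fun s w c z => Q s w z /\ z 0 i < c)).
  apply: definable_and => //.
  have := @definable_lt R _ _ (is_pexpX R (3 + i)%N) (is_pexpX R 2%N).
  by apply: definable_ext => e; rewrite mxE.
have := definable_ex 2 (definable_and
   (@definable_eq R _ _ (is_pexpX R 2%N) (is_pexpX R (3 + i)%N)) dlt).
move/definable_not/(definable_and dQ); apply: definable_ext => e.
split=> -[Qz Hz]; split=> //.
  move=> z' Qz'; rewrite leNgt; apply/negP => lt; apply: Hz; exists (e (3 + i)%N).
  by split=> //; exists z'; split=> //; move: lt; rewrite mxE.
move=> [x [/= Ex [z' [Qz' lt]]]].
have := Hz z' Qz'; rewrite leNgt => /negP; apply.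
by move: lt Ex; rewrite mxE /upd /= => lt <-.
Qed.

Fixpoint least_coords (l : seq 'I_n) Q :=
  if l is i :: l' then least_coord i (least_coords l' Q) else Q.

Lemma definable_least_coords l Q : definable_family Q ->
  definable_family (least_coords l Q).
Proof. by move=> dQ; elim: l => //= i l; exact: definable_least_coord. Qed.

Lemma least_coords_sub l Q s w z : least_coords l Q s w z -> Q s w z.
Proof. by elim: l => //= i l IH [/IH]. Qed.

(** Once every coordinate has been minimized only one point is left. *)
Lemma least_coords_uniq Q s w z z' : least_coords (enum 'I_n) Q s w z ->
  least_coords (enum 'I_n) Q s w z' -> z = z'.
Proof.
have le l a b : least_coords l Q s w a -> least_coords l Q s w b ->
    forall i, i \in l -> a 0 i <= b 0 i.
  elim: l => //= j l IH [la Ha] [lb Hb] i; rewrite inE => /orP[/eqP->|il].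
    exact: Ha.
  exact: IH.
move=> Hz Hz'; apply/rowP => i; apply/eqP.
by rewrite eq_le (le _ _ _ Hz Hz') ?(le _ _ _ Hz' Hz) ?mem_enum.
Qed.

End Blocks.

Section Selection.
Variables (R : realType) (n : nat).

Lemma ev_continuous (P : pexp R 'I_n) : continuous (fun z : 'rV[R]_n => ev (z 0) P).
Proof.
elim: P => [c|i|P HP Q HQ|P HP Q HQ] z /=.
- exact: cst_continuous.
- exact: coord_continuous.
- exact: (cvgD (HP z) (HQ z)).
- exact: (cvgM (HP z) (HQ z)).
Qed.

Lemma is_pexp_continuous (f : ('I_n -> R) -> R) : is_pexp f ->
  continuous (fun z : 'rV[R]_n => f (z 0)).
Proof.
move=> [P HP]; suff -> : (fun z : 'rV[R]_n => f (z 0)) = (fun z => ev (z 0) P).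
  exact: ev_continuous.
by apply/funext => z; exact: HP.
Qed.

Lemma norm_rV_le (z : 'rV[R]_n) r : 0 <= r -> (forall i, `|z 0 i| <= r) -> `|z| <= r.
Proof.
move=> r0 H; rewrite [leLHS]/Num.norm /= mx_normrE; apply: bigmax_le => //= -[i j] _ /=.
by rewrite (ord1 i).
Qed.

Lemma coord_norm_le (z : 'rV[R]_n) i : `|z 0 i| <= `|z|.
Proof.
by rewrite [leRHS]/Num.norm /= mx_normrE; apply/bigmax_geP; right => /=; exists (0, i).
Qed.

Lemma sumsq_coord_le (z : 'I_n -> R) r : 0 <= r ->
  \sum_i z i ^+ 2 <= r ^+ 2 -> forall i, `|z i| <= r.
Proof.
move=> r0 Hr i; rewrite -(ler_pXn2r (ltn0Sn 1)) ?nnegrE // -normrX.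
rewrite ger0_norm ?sqr_ge0 //; apply: le_trans Hr.
by rewrite (bigD1 i) //= lerDl sumr_ge0 // => j _; rewrite sqr_ge0.
Qed.

Lemma compact_least_coord (Q : R -> R -> 'rV[R]_n -> Prop) s w i :
  compact [set z | Q s w z] -> [set z | Q s w z] !=set0 ->
  compact [set z | least_coord i Q s w z] /\ [set z | least_coord i Q s w z] !=set0.
Proof.
move=> cQ Q0.
have cc : continuous (fun z : 'rV[R]_n => z 0 i) by exact: coord_continuous.
have [z0 /set_mem Qz0 Hz0] := EVT_min_rV Q0 cQ (continuous_subspaceT cc).
have min z : Q s w z -> z0 0 i <= z 0 i by move=> Qz; apply: Hz0; rewrite inE.
split; last by exists z0; split.
suff -> : [set z | least_coord i Q s w z] =
    [set z | Q s w z] `&` ((fun z : 'rV[R]_n => z 0 i) @^-1` [set x | x <= z0 0 i]).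
  apply: compact_closedI => //.
  by apply: preimage_closed; [move=> z _; exact: cc|exact: closed_le].
apply/seteqP; split=> z [Qz /= Hz]; split=> //.
  exact: Hz.
by move=> z' Qz'; apply: le_trans Hz (min _ Qz').
Qed.

(** Minimizing the coordinates one after the other selects a point in each
    compact fibre; the conclusion gives the definability of the selected
    coordinates through their strict hypographs, the form that
    [definable_changes_le] needs. *)
Lemma definable_selection (Q : R -> R -> 'rV[R]_n -> Prop) w (D : set R) :
  definable_family Q ->
  (forall s, D s -> compact [set z | Q s w z]) ->
  (forall s, D s -> exists z, Q s w z) ->
  exists xi : R -> 'rV[R]_n, (forall s, D s -> Q s w (xi s)) /\
    forall i, exists2 P : (nat -> R) -> Prop, definable P &
      forall s c, D s -> P (nth 0 [:: s; w; c]) <-> c < xi s 0 i.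
Proof.
move=> dQ cQ Q0; pose Q' := least_coords (enum 'I_n) Q.
have Q'0 s : D s -> exists z, Q' s w z.
  move=> Ds.
  suff : compact [set z | Q' s w z] /\ [set z | Q' s w z] !=set0 by case.
  rewrite /Q'; elim: (enum _) => [|i l [IH1 IH2]] /=.
    by split; [exact: cQ|exact: Q0].
  exact: compact_least_coord.
pose xi s := xget 0 [set z | Q' s w z].
have Q'xi s : D s -> Q' s w (xi s) by move=> /Q'0[z]; apply: xgetI.
exists xi; split=> [s /Q'xi/least_coords_sub//|i].
exists (fun e => exists z, Q' (e 0%N) (e 1%N) z /\ e 2%N < z 0 i).
  apply: (@definable_ex_point _ _ (fun s w c z => Q' s w z /\ c < z 0 i)).
  apply: definable_and; first exact: definable_least_coords.
  have := @definable_lt R _ _ (is_pexpX R 2%N) (is_pexpX R (3 + i)%N).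
  by apply: definable_ext => e; rewrite mxE.
move=> s c Ds /=; split=> [[z [Qz cz]]|cxi].
  by rewrite (least_coords_uniq (Q'xi s Ds) Qz).
by exists (xi s); split=> //; exact: Q'xi.
Qed.

End Selection.

(** * The gradient inequality for polynomials *)

Section SlowPoints.
Variables (R : realType) (n : nat) (h : pexp R 'I_n) (r : R).
Hypothesis r0 : 0 <= r.

(** Points of the ball of radius [r] on the level [h = s] at which the gradient of
    [log h] has norm at most [1 / w]. *)
Definition slow (s w : R) (z : 'rV[R]_n) :=
  [/\ 0 < s, ev (z 0) h = s, w ^+ 2 * \sum_i ev (z 0) (pd i h) ^+ 2 <= s ^+ 2
    & \sum_i z 0 i ^+ 2 <= r ^+ 2].

Lemma definable_slow : definable_family slow.
Proof.
have Ep (e : nat -> R) (P : pexp R 'I_n) :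
    ev ((point_of n e) 0) P = ev (fun i : 'I_n => e (3 + i)%N) P.
  by apply: eq_pev => // i; rewrite mxE.
have d1 := @definable_lt R _ _ (is_pexpC _ 0) (is_pexpX R 0%N).
have d2 := @definable_eq R _ _ (is_pexp_ev h (fun i : 'I_n => (3 + i)%N))
  (is_pexpX R 0%N).
have d3 := @definable_le R _ _ (is_pexpM (is_pexp_sqr (is_pexpX R 1%N))
  (@is_pexp_sum R nat _ (index_enum 'I_n) _
     (fun i => is_pexp_sqr (is_pexp_ev (pd i h) (fun j : 'I_n => (3 + j)%N)))))
  (is_pexp_sqr (is_pexpX R 0%N)).
have d4 := @definable_le R _ _ (@is_pexp_sum R nat _ (index_enum 'I_n) _
     (fun i : 'I_n => is_pexp_sqr (is_pexpX R (3 + i)%N)))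
  (is_pexpC _ (r ^+ 2)).
have := definable_and (definable_and d1 d2) (definable_and d3 d4).
apply: definable_ext => e; rewrite /slow Ep.
under [in X in _ <-> X]eq_bigr do rewrite Ep.
under [X in _ <-> [/\ _, _, _ & X <= _]]eq_bigr do rewrite mxE.
by split=> [[[? ?] [? ?]]|[]].
Qed.

Lemma slow_coord_le s w z i : slow s w z -> `|z 0 i| <= r.
Proof. by move=> [_ _ _ H]; apply: (sumsq_coord_le r0 H). Qed.

Lemma compact_slow s w : 0 < s -> compact [set z | slow s w z].
Proof.
move=> s0; apply: bounded_closed_compact.
  exists r; split; first exact: num_real.
  move=> M rM z /= Hz; apply: le_trans (ltW rM).
  by apply: norm_rV_le => // i; exact: slow_coord_le Hz.
pose f1 (z : 'rV[R]_n) := ev (z 0) h.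
pose f2 (z : 'rV[R]_n) := w ^+ 2 * \sum_i ev (z 0) (pd i h) ^+ 2.
pose f3 (z : 'rV[R]_n) := \sum_i z 0 i ^+ 2.
have c1 : continuous f1 by exact: ev_continuous.
have c2 : continuous f2.
  have := @is_pexp_continuous R n (fun e => w ^+ 2 * \sum_i ev e (pd i h) ^+ 2).
  apply; apply: is_pexpM; first exact: is_pexpC.
  by apply: is_pexp_sum => i; apply: is_pexp_sqr; exists (pd i h).
have c3 : continuous f3.
  have := @is_pexp_continuous R n (fun e => \sum_i e i ^+ 2).
  by apply; apply: is_pexp_sum => i; apply: is_pexp_sqr; apply: is_pexpX.
have -> : [set z | slow s w z] = (f1 @^-1` [set x | x = s]) `&`
    ((f2 @^-1` [set x | x <= s ^+ 2]) `&` (f3 @^-1` [set x | x <= r ^+ 2])).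
  by apply/seteqP; split=> z /= => [[]|[? []]].
apply: closedI; first by apply: preimage_closed; [move=> z _; exact: c1|exact: closed_eq].
by apply: closedI; apply: preimage_closed; try exact: closed_le;
  move=> z _; [exact: c2|exact: c3].
Qed.

End SlowPoints.

Section Lojasiewicz.
Variables (R : realType) (n : nat) (h : pexp R 'I_n) (r : R).
Hypothesis r0 : 0 <= r.

Lemma definable_slow_levels :
  definable (fun e => exists z, slow h r (e 0%N) (e 1%N) z).
Proof.
exact: (definable_ex_point (Q := fun s w _ z => slow h r s w z)
  (definable_slow h r)).
Qed.

(** Each coordinate of a definable choice of slow points crosses each constant a
    bounded number of times and stays in [[-r, r]], so it has bounded variation
    by [sum_dist_le_crossings]. *)
Lemma selection_variation_le (d e0 : R) :
  (forall s : R, 0 < s < e0 -> exists z, slow h r s d z) ->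
  exists xi : R -> 'rV[R]_n, (forall s, 0 < s < e0 -> slow h r s d (xi s)) /\
    exists T : R, forall (s_ : nat -> R) M, (forall j, 0 < s_ j < e0) ->
      (forall j, s_ j <= s_ j.+1) ->
      \sum_(j < M) \sum_i `|xi (s_ j.+1) 0 i - xi (s_ j) 0 i| <= T.
Proof.
move=> ex_slow.
have comp s : 0 < s < e0 -> compact [set z | slow h r s d z].
  by move=> /andP[s0 _]; exact: compact_slow.
have [xi [slow_xi Hxi]] :=
  definable_selection (definable_slow h r) (D := [set s | 0 < s < e0]) comp ex_slow.
exists xi; split=> //.
have HK i : exists K : R, forall (s_ : nat -> R) M, (forall j, 0 < s_ j < e0) ->
    (forall j, s_ j <= s_ j.+1) ->
    \sum_(j < M) `|xi (s_ j.+1) 0 i - xi (s_ j) 0 i| <= K.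
  have [P dP HP] := Hxi i.
  have [K HK] := definable_changes_le d dP.
  exists (K%:R * (2 * r)) => s_ M s_in inc.
  apply: (@sum_dist_le_crossings R (fun j => xi (s_ j) 0 i)) => [j|c].
    exact: (slow_coord_le r0 i (slow_xi _ (s_in j))).
  apply: leq_trans (HK c s_ M inc); apply: eq_leq; apply: eq_bigr => j _.
  have E k : (c < xi (s_ k) 0 i) = `[< P (nth 0 [:: s_ k; d; c]) >].
    by apply/idP/asboolP => /(HP _ c (s_in k)).
  by rewrite !E.
have [K {}HK] := choice HK.
exists (\sum_i K i) => s_ M s_in inc; rewrite exchange_big /=.
by apply: ler_sum => i _; apply: HK.
Qed.

(** If [h] grows by the factor [1 + k] between two slow points, their distance is
    at least of order [k], because [log h] has slope at most [1 / d] there. By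
    Taylor, with [a] the distance, [s * k <= a * (s / d + M * a)]; the hypothesis
    [M * k <= s] makes the quadratic term harmless. *)
Lemma slow_increment_ge (d : R) : 0 < d -> exists2 M : R, 0 <= M &
  forall (k s s' : R) z z', slow h r s d z -> slow h r s' d z' ->
  s * k <= s' - s -> 0 <= k -> M * k <= s ->
  k * d / 2 <= \sum_i `|z' 0 i - z 0 i|.
Proof.
move=> d0; have [M M0 HM] := ev_taylor h r.
exists (M * (d ^+ 2 / 2)) => [|k s s' z z' Sz Sz' ks k0 Mk].
  by rewrite mulr_ge0 // divr_ge0 ?sqr_ge0.
have := HM (z 0) (z' 0) (fun i => slow_coord_le r0 i Sz)
  (fun i => slow_coord_le r0 i Sz').
have [s0 Es Hd _] := Sz; have [s'0 Es' _ _] := Sz'; rewrite Es Es'.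
have gradle i : `|ev (z 0) (pd i h)| <= s / d.
  apply: (@sumsq_coord_le R n (fun i => ev (z 0) (pd i h))).
    by rewrite divr_ge0 // ltW.
  by rewrite expr_div_n ler_pdivlMr ?exprn_gt0 // mulrC.
set a := \sum_i `|_ - _|; set D := \sum_i _ * _ => Hs.
have a0 : 0 <= a by rewrite sumr_ge0.
have HD : D <= s / d * a.
  apply: le_trans (ler_norm _) _; apply: le_trans (ler_norm_sum _ _ _) _.
  rewrite mulr_sumr; apply: ler_sum => i _; rewrite normrM ler_wpM2r //.
have {Hs} Hs : s * k <= a * (s / d + M * a).
  apply: le_trans ks _.
  have := ler_norm (s' - s - D).
  have : a * (s / d + M * a) = s / d * a + M * a ^+ 2 by ring.
  by move=> ->; lra.
rewrite leNgt; apply/negP => alt.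
have Ma : M * a <= s / d.
  rewrite ler_pdivlMr //; apply: le_trans Mk.
  apply: (@le_trans _ _ (M * (k * d / 2) * d)).
    by rewrite ler_pM2r // ler_wpM2l // ltW.
  by rewrite le_eqVlt; apply/orP; left; apply/eqP; field.
have sd0 : 0 < s / d by rewrite divr_gt0.
have : a * (s / d + M * a) < k * d / 2 * (s / d + s / d).
  apply: (@le_lt_trans _ _ (a * (s / d + s / d))).
    by rewrite ler_wpM2l // lerD2l.
  by rewrite ltr_pM2r // addr_gt0.
have -> : k * d / 2 * (s / d + s / d) = s * k by field; exact: lt0r_neq0.
by rewrite ltNge Hs.
Qed.

(** Assume slow points exist on all small levels and choose them definably. Split
    a range of levels of ratio [expR tau] geometrically into [J] steps of ratio
    [expR (tau / J)]: by [slow_increment_ge] the variation is at least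
    [J * (tau / J) * d / 2 = tau * d / 2], which exceeds the bound [T] as soon as
    [tau] is large. *)
Lemma no_slow_points (d : R) : 0 < d ->
  exists2 e : R, 0 < e & forall (s : R) z, 0 < s < e -> ~ slow h r s d z.
Proof.
move=> d0; apply: contrapT => nex.
have [e0 e00 He0] : exists2 e : R, 0 < e &
    forall s, 0 < s < e -> exists z, slow h r s d z.
  apply: (definable_dichotomy (w := d) (c := 0) definable_slow_levels) => e e0.
  apply: contrapT => nex'; apply: nex; exists e => // s z Hs Sz.
  by apply: nex'; exists s => //=; exists z.
have [xi [slow_xi [T HT]]] := selection_variation_le He0.
have [M M0 HM] := slow_increment_ge d0.
pose tau := 2 * (`|T| + 1) / d.
have tau0 : 0 < tau by rewrite divr_gt0 // mulr_gt0 // ltr_wpDl.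
(* The levels [s_ j] run from [sg] to [sg * expR tau = e0 / 2]. *)
pose sg := e0 / (2 * expR tau).
have sg0 : 0 < sg by rewrite divr_gt0 // mulr_gt0 // expR_gt0.
pose J := (Num.bound (M * tau / sg)).+1.
have J0 : 0 < J%:R :> R by rewrite ltr0n.
have MJ : M * (tau / J%:R) <= sg.
  rewrite mulrA ler_pdivrMr // [sg * _]mulrC -ler_pdivrMr // ltW //.
  have /archi_boundP : 0 <= M * tau / sg.
    by exact: divr_ge0 (mulr_ge0 M0 (ltW tau0)) (ltW sg0).
  by move=> lt1; apply: (lt_trans lt1); rewrite ltr_nat.
(* Constant from [J] on, so that all levels stay below [e0]. *)
pose s_ j := sg * expR (tau * (minn j J)%:R / J%:R).
have s_lt j : s_ j < e0.
  apply: (@le_lt_trans _ _ (sg * expR tau)).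
    rewrite ler_pM2l // ler_expR ler_pdivrMr // ler_pM2l // ler_nat.
    exact: geq_minr.
  rewrite /sg invfM mulrA -mulrA mulVf ?gt_eqF ?expR_gt0 // mulr1.
  by rewrite ltr_pdivrMr // ltr_pMr // ltr1n.
have s_ge j : sg <= s_ j.
  rewrite ler_pMr // -[leLHS]expR0 ler_expR.
  exact: divr_ge0 (mulr_ge0 (ltW tau0) (ler0n _ _)) (ltW J0).
have s_in j : 0 < s_ j < e0 by rewrite (lt_le_trans sg0 (s_ge j)) s_lt.
have s_inc j : s_ j <= s_ j.+1.
  rewrite ler_pM2l // ler_expR ler_pM2r ?invr_gt0 // ler_pM2l // ler_nat.
  by lia.
have := HT s_ J s_in s_inc; apply/negP; rewrite -ltNge.
have step (j : 'I_J) : tau / J%:R * d / 2 <=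
    \sum_i `|xi (s_ j.+1) 0 i - xi (s_ j) 0 i|.
  apply: (HM _ (s_ j) (s_ j.+1)); try exact: slow_xi.
  - have -> : s_ j.+1 = s_ j * expR (tau / J%:R).
      rewrite /s_ -[RHS]mulrA -expRD.
      rewrite (minn_idPl (ltn_ord j)) (minn_idPl (ltnW (ltn_ord j))).
      by congr (_ * expR _); rewrite -[in LHS]natr1; field; exact: lt0r_neq0.
    rewrite -[X in _ - X]mulr1 -mulrBr ler_pM2l; last by case/andP: (s_in j).
    by rewrite lerBrDl expR_ge1Dx.
  - by rewrite divr_ge0 // ltW.
  - exact: le_trans MJ (s_ge j).
apply: (@lt_le_trans _ _ (\sum_(j < J) tau / J%:R * d / 2)); last first.
  by apply: ler_sum => j _; apply: step.
rewrite sumr_const card_ord -[ltRHS]mulr_natr.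
have -> : tau / J%:R * d / 2 * J%:R = `|T| + 1.
  by rewrite /tau; field; rewrite !lt0r_neq0.
by rewrite (le_lt_trans (ler_norm _)) // ltrDl.
Qed.

(** With [D] the norm of the gradient, the point [z] is slow for [w = s / D].
    As [w] is small by [no_slow_points], it is bounded by a power of [s] by
    [definable_power_bound]: [(s / D) ^+ q <= C * s]. *)
Lemma lojasiewicz_pos : exists eps theta c : R,
  [/\ 0 < eps, 0 < theta, theta <= 1 / 2 & 0 <= c /\
    forall z : 'rV[R]_n, \sum_i z 0 i ^+ 2 <= r ^+ 2 -> 0 < ev (z 0) h < eps ->
    ev (z 0) h `^ (1 - theta) <= c * \sum_i `|ev (z 0) (pd i h)|].
Proof.
have [eta [j [C [eta0 eta1 C0 HC]]]] := definable_power_bound 0 definable_slow_levels.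
have [e e0 He] := no_slow_points eta0.
(* [j.+2] instead of [j] makes the exponent [1 / q] at most [1 / 2]. *)
pose q := j.+2; have q0 : 0 < q%:R :> R by rewrite ltr0n.
exists (Num.min 1 e), q%:R^-1, (C `^ q%:R^-1); split.
- by rewrite lt_min ltr01.
- by rewrite invr_gt0.
- by rewrite div1r lef_pV2 ?posrE // ler_nat.
split; first exact: powR_ge0.
move=> z Hz; set s := ev (z 0) h; rewrite lt_min => /and3P[s0 s1 se].
pose D2 := \sum_i ev (z 0) (pd i h) ^+ 2; pose D := Num.sqrt D2.
have D20 : 0 <= D2 by rewrite sumr_ge0 // => i _; rewrite sqr_ge0.
have DD : D ^+ 2 = D2 by rewrite sqr_sqrtr.
have nslow : ~ slow h r s eta z by apply: He; rewrite s0.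
have D0 : 0 < D.
  rewrite lt_neqAle sqrtr_ge0 andbT; apply/eqP => ED; apply: nslow; split=> //.
  by rewrite -/D2 -DD -ED expr0n /= mulr0 sqr_ge0.
pose w := s / D.
have w0 : 0 < w by rewrite divr_gt0.
have we : w < eta.
  rewrite ltNge; apply/negP => ew; apply: nslow; split=> //.
  rewrite -/D2 -DD -exprMn ler_pXn2r ?nnegrE ?mulr_ge0 ?(ltW eta0) ?(ltW D0) ?(ltW s0) //.
  by rewrite -ler_pdivlMr.
have wj : w ^+ j <= C * s.
  apply: (HC s w); rewrite ?s0 ?(ltW w0) ?(ltW we) ?(ltW s1) //=.
    exists z; split=> //; rewrite -/D2 -DD -exprMn /w divfK //; exact: lt0r_neq0.
  move=> [z' Sz']; apply: (He s z') => //; first by rewrite s0.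
have wq : w ^+ q <= C * s.
  apply: le_trans wj; apply: ler_wiXn2l; rewrite ?(ltW w0) ?(le_trans (ltW we)) //.
  by rewrite /q; lia.
have key : s ^+ j.+1 <= C * D ^+ q.
  have : s ^+ q <= C * s * D ^+ q.
    by rewrite -ler_pdivrMr ?exprn_gt0 // -expr_div_n.
  by rewrite /q exprS mulrAC mulrC ler_pM2r.
have -> : s `^ (1 - q%:R^-1) = (s ^+ j.+1) `^ q%:R^-1.
  rewrite -powR_mulrn ?(ltW s0) // -powRrM; congr (_ `^ _).
  have -> : j.+1%:R = q%:R - 1 :> R by rewrite /q -[j.+2%:R]natr1 addrK.
  by rewrite mulrBl mul1r mulfV ?lt0r_neq0.
apply: (@le_trans _ _ ((C * D ^+ q) `^ q%:R^-1)).
  have nn1 : s ^+ j.+1 \in Num.nneg by rewrite nnegrE exprn_ge0 // ltW.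
  have nn2 : C * D ^+ q \in Num.nneg by rewrite nnegrE mulr_ge0 // exprn_ge0 // ltW.
  by apply: ge0_ler_powR nn1 nn2 key; rewrite invr_ge0 ltW.
rewrite powRM ?exprn_ge0 ?(ltW D0) // -[D ^+ q]powR_mulrn ?(ltW D0) // -powRrM.
rewrite mulfV ?lt0r_neq0 // powRr1 ?(ltW D0) // ler_wpM2l ?powR_ge0 //.
rewrite -(ler_pXn2r (ltn0Sn 1)) ?nnegrE ?(ltW D0) ?sumr_ge0 // DD.
rewrite expr2 mulr_suml; apply: ler_sum => i _.
rewrite -real_normK ?num_real // expr2 ler_wpM2l //.
by rewrite (bigD1 i) //= lerDl sumr_ge0.
Qed.

End Lojasiewicz.

Section TwoSided.
Variables (R : realType) (n : nat) (h : pexp R 'I_n) (r : R).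

(** The negative levels of [h] are the positive ones of [- h]. *)
Theorem lojasiewicz_gradient : 0 <= r -> exists eps theta c : R,
  [/\ 0 < eps, 0 < theta, theta <= 1 / 2 & 0 <= c /\
    forall z : 'rV[R]_n, \sum_i z 0 i ^+ 2 <= r ^+ 2 -> `|ev (z 0) h| < eps ->
    `|ev (z 0) h| `^ (1 - theta) <= c * \sum_i `|ev (z 0) (pd i h)|].
Proof.
move=> r0; have [e1 [t1 [c1 [e10 t10 t1h [c10 H1]]]]] := lojasiewicz_pos h r0.
have [e2 [t2 [c2 [e20 t20 t2h [c20 H2]]]]] := lojasiewicz_pos (PM (PC (-1)) h) r0.
pose t := Num.min t1 t2; pose c := Num.max c1 c2.
have th : t <= 1 / 2 by rewrite ge_min t1h.
exists (Num.min 1 (Num.min e1 e2)), t, c.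
split; [by rewrite !lt_min ltr01 e10|by rewrite lt_min t10|by []|].
split=> [|z Hz]; first by rewrite le_max c10.
rewrite !lt_min => /and3P[h1 he1 he2].
set S := \sum_i _; have S0 : 0 <= S by rewrite sumr_ge0.
have [h0|hn0] := eqVneq (ev (z 0) h) 0.
  rewrite h0 normr0 powR0; last by rewrite gt_eqF // subr_gt0; lra.
  by rewrite mulr_ge0 // le_max c10.
have hp : 0 < `|ev (z 0) h| by rewrite normr_gt0.
have mono t' : t <= t' -> `|ev (z 0) h| `^ (1 - t) <= `|ev (z 0) h| `^ (1 - t').
  by move=> tt; apply: ger_powR; [rewrite hp ltW|rewrite lerD2l lerN2].
have [hpos|hneg] := ltP 0 (ev (z 0) h).
  apply: le_trans (mono t1 _) _; first by rewrite ge_min lexx.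
  move: he1; rewrite (ger0_norm (ltW hpos)) => he1.
  apply: le_trans (H1 z Hz _) _; first by rewrite hpos.
  by rewrite ler_wpM2r // le_max lexx.
apply: le_trans (mono t2 _) _; first by rewrite ge_min lexx orbT.
have Eh : `|ev (z 0) h| = ev (z 0) (PM (PC (-1)) h) by rewrite ler0_norm //= mulN1r.
rewrite Eh; apply: le_trans (H2 z Hz _) _; first by rewrite -Eh hp.
under eq_bigr do rewrite /= mul0r add0r mulN1r normrN.
by rewrite ler_wpM2r // le_max lexx orbT.
Qed.

(** An error of order [a] is negligible compared with [a `^ (1 - theta)]. *)
Lemma powR_absorb (theta C1 C2 : R) : 0 < theta -> 0 <= C2 ->
  exists2 eps : R, 0 < eps & forall a E, 0 <= a < eps ->
    a `^ (1 - theta) <= C1 * E + C2 * a -> a `^ (1 - theta) <= 2 * C1 * E.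
Proof.
move=> t0 C20; pose b := (2 * (C2 + 1))^-1.
have b0 : 0 < b by rewrite invr_gt0 mulr_gt0 // ltr_wpDl.
exists (b `^ theta^-1) => [|a E /andP[a0 ab] H]; first exact: powR_gt0.
have [az|an0] := eqVneq a 0.
  move: H; rewrite az; have [t1|t1] := eqVneq (1 - theta) 0; last first.
    by rewrite powR0 // mulr0 addr0 -mulrA; lra.
  by rewrite t1 powRr0 mulr0 addr0 -mulrA; lra.
have ap : 0 < a by rewrite lt_neqAle eq_sym an0.
have at_ : a `^ theta <= b.
  have -> : b = (b `^ theta^-1) `^ theta.
    by rewrite -powRrM mulVf ?gt_eqF // powRr1 // ltW.
  by apply: ge0_ler_powR; rewrite ?nnegrE ?powR_ge0 ?ltW.
have Ea : a = a `^ (1 - theta) * a `^ theta.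
  by rewrite -powRD ?an0 ?implybT // subrK powRr1.
set A := a `^ (1 - theta) in H Ea *.
have A0 : 0 <= A by exact: powR_ge0.
have : C2 * a <= A / 2.
  rewrite Ea mulrCA ler_wpM2l //.
  apply: (@le_trans _ _ (C2 * b)); first by rewrite ler_wpM2l.
  have -> : 2^-1 = (C2 + 1) * b :> R.
    by rewrite /b invfM mulrCA mulfV ?mulr1 // gt_eqF // ltr_wpDl.
  by rewrite ler_pM2r // lerDl.
by rewrite -mulrA; lra.
Qed.

End TwoSided.

(** * Directional derivatives *)

Section Derivatives.
Variables (R : realType) (n : nat).
Implicit Types (P Q : pexp R 'I_n) (x v : 'rV[R]_n).

Definition dirder P x v := \sum_i ev (x 0) (pd i P) * v 0 i.

Lemma is_derive_coord (i : 'I_n) x v : is_derive x v (fun z : 'rV[R]_n => z 0 i) (v 0 i).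
Proof.
have cv : h^-1 *: (((fun z : 'rV[R]_n => z 0 i) \o shift x) (h *: v) - x 0 i)
    @[h --> (0 : R)^'] --> v 0 i.
  apply: cvg_near_cst; near=> h.
  have h0 : h != 0 by near: h; exact: nbhs_dnbhs_neq.
  by rewrite /= !mxE addrK /GRing.scale /= mulrA mulVf // mul1r.
by apply: DeriveDef; [apply/cvg_ex; exists (v 0 i)|apply: cvg_lim].
Unshelve. all: by end_near.
Qed.

Lemma is_derive_ev P x v : is_derive x v (fun z : 'rV[R]_n => ev (z 0) P) (dirder P x v).
Proof.
rewrite /dirder; elim: P => [c|j|P HP Q HQ|P HP Q HQ] /=.
- rewrite big1 => [|i _]; last by rewrite mul0r.
  exact: is_derive_cst.
- rewrite (bigD1 j) //= eqxx mul1r big1 ?addr0; first exact: is_derive_coord.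
  by move=> i /negbTE ij; rewrite eq_sym ij mul0r.
- have -> : \sum_i (ev (x 0) (pd i P) + ev (x 0) (pd i Q)) * v 0 i =
    \sum_i ev (x 0) (pd i P) * v 0 i + \sum_i ev (x 0) (pd i Q) * v 0 i.
    by rewrite -big_split; apply: eq_bigr => i _; rewrite mulrDl.
  exact: is_deriveD.
- have -> : \sum_i (ev (x 0) (pd i P) * ev (x 0) Q +
                    ev (x 0) P * ev (x 0) (pd i Q)) * v 0 i
     = ev (x 0) P *: (\sum_i ev (x 0) (pd i Q) * v 0 i) +
       ev (x 0) Q *: (\sum_i ev (x 0) (pd i P) * v 0 i).
    rewrite /GRing.scale /= !mulr_sumr -big_split; apply: eq_bigr => i _ /=; ring.
  exact: is_deriveM.
Qed.

(** Formal derivatives of different expressions of one polynomial function agree,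
    being equal to its analytic derivatives. *)
Lemma ev_pd_ext P Q : (forall z : 'rV[R]_n, ev (z 0) P = ev (z 0) Q) ->
  forall (z : 'rV[R]_n) i, ev (z 0) (pd i P) = ev (z 0) (pd i Q).
Proof.
move=> PQ z i.
have D P' : 'D_(delta_mx 0 i) (fun z : 'rV[R]_n => ev (z 0) P') z = ev (z 0) (pd i P').
  have dP := is_derive_ev P' z (delta_mx 0 i); rewrite derive_val /dirder.
  rewrite (bigD1 i) //= mxE !eqxx mulr1 big1 ?addr0 // => j ji.
  by rewrite mxE (negbTE ji) andbF mulr0.
by rewrite -!D; congr ('D_ _ _ _); apply/funext => y; exact: PQ.
Qed.

Lemma derive_quotient P Q x v : ev (x 0) Q != 0 ->
  'D_v (fun z : 'rV[R]_n => ev (z 0) P / ev (z 0) Q) x =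
  (dirder P x v * ev (x 0) Q - ev (x 0) P * dirder Q x v) / ev (x 0) Q ^+ 2.
Proof.
move=> Q0; have dP := is_derive_ev P x v; have dQ := is_derive_ev Q x v.
have dQ' : derivable (fun z : 'rV[R]_n => ev (z 0) Q) x v by exact: ex_derive.
have dV := DeriveDef (derivableV Q0 dQ') (deriveV Q0 dQ').
have -> : (fun z : 'rV[R]_n => ev (z 0) P / ev (z 0) Q) =
  (fun z : 'rV[R]_n => ev (z 0) P) * (fun z : 'rV[R]_n => (ev (z 0) Q)^-1) by [].
have dM := is_deriveM dP dV; rewrite derive_val.
rewrite (@derive_val _ _ _ _ _ _ _ dQ) /GRing.scale /=.
by field.
Qed.

End Derivatives.

(** * Blowing up a point *)

Notation quo := (var_quo ord0).

Section Polar.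
Variables (R : realType) (n : nat).
Implicit Types (P Q : pexp R 'I_n) (F G : pexp R 'I_n.+1) (t : R) (v a : 'rV[R]_n).

(** The pair [(t, v)] as one row vector, with the radius [t] at index [ord0]. *)
Definition polar t v : 'rV[R]_n.+1 :=
  \row_i (if unlift ord0 i is Some k then v 0 k else t).

Lemma polar0 t v : polar t v 0 ord0 = t.
Proof. by rewrite mxE unlift_none. Qed.

Lemma polarS t v i : polar t v 0 (lift ord0 i) = v 0 i.
Proof. by rewrite mxE liftK. Qed.

Lemma polar_surj (z : 'rV[R]_n.+1) : z = polar (z 0 ord0) (\row_i z 0 (lift ord0 i)).
Proof.
by apply/rowP => i; case: (unliftP ord0 i) => [j|] ->; rewrite ?polar0 ?polarS ?mxE.
Qed.

Definition blowup a P : pexp R 'I_n.+1 :=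
  psubst (fun i => PA (PM (PX ord0) (PX (lift ord0 i))) (PC (a 0 i))) P.

Lemma ev_blowup a P t v : ev (polar t v 0) (blowup a P) = ev ((t *: v + a) 0) P.
Proof.
rewrite pev_subst; apply: eq_pev => // i /=.
by rewrite !mxE unlift_none liftK.
Qed.

Lemma pd_subst (V W : finType) (s : V -> pexp R W) (e : W -> R) (j : W) (P : pexp R V) :
  ev e (pd j (psubst s P)) =
  \sum_i ev (fun k => ev e (s k)) (pd i P) * ev e (pd j (s i)).
Proof.
elim: P => [c|k|P1 H1 P2 H2|P1 H1 P2 H2] /=.
- by rewrite big1 // => i _; rewrite mul0r.
- rewrite (bigD1 k) //= eqxx mul1r big1 ?addr0 // => i /negbTE ik.
  by rewrite eq_sym ik mul0r.
- by rewrite H1 H2 -big_split; apply: eq_bigr => i _ /=; rewrite mulrDl.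
- rewrite H1 H2 !pev_subst mulr_suml mulr_sumr -big_split.
  by apply: eq_bigr => i _ /=; ring.
Qed.

Lemma pd_blowup_direction a P t v i :
  ev (polar t v 0) (pd (lift ord0 i) (blowup a P)) = t * ev ((t *: v + a) 0) (pd i P).
Proof.
rewrite pd_subst (bigD1 i) //= eqxx polar0 polarS mulr1 addr0.
rewrite mul0r add0r big1 ?addr0; last first.
  move=> k ki; rewrite mul0r add0r addr0.
  by rewrite (inj_eq lift_inj) (negbTE ki) !mulr0.
rewrite mulrC; congr (_ * _); apply: eq_pev => // k /=.
by rewrite polarS !mxE.
Qed.

Lemma pd_blowup_radius a P t v :
  ev (polar t v 0) (pd ord0 (blowup a P)) = dirder P (t *: v + a) v.
Proof.
rewrite pd_subst /dirder; apply: eq_bigr => i _ /=.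
rewrite mul1r polarS mulr0 !addr0.
congr (_ * _); apply: eq_pev => // k /=.
by rewrite polar0 polarS !mxE.
Qed.

(** Restriction to the ray through [v], as a polynomial in the radius. *)
Definition ray v F : {poly R} :=
  pev polyC (fun i => if unlift ord0 i is Some k then (v 0 k)%:P else 'X) F.

Lemma rayE v F t : (ray v F).[t] = ev (polar t v 0) F.
Proof.
rewrite -horner_evalE rmorph_pev; apply: eq_pev => [x|i] /=.
  by rewrite horner_evalE hornerC.
by rewrite horner_evalE mxE; case: (unlift ord0 i) => [k|]; rewrite ?hornerC ?hornerX.
Qed.

Lemma ray_quo v F : ray v F = (ev (polar 0 v 0) F)%:P + 'X * ray v (quo F).
Proof.
rewrite {1}/ray (@pev_var_quo _ _ ord0) unlift_none -/(ray v (quo F)); congr (_ + _).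
rewrite (@rmorph_pev _ _ R _ id (polar 0 v 0) polyC); apply: eq_pev => // i /=.
by rewrite mxE; case: (unliftP ord0 i) => [j|] ->.
Qed.

(** Repeated division by [t] computes the Taylor coefficients in [t] as
    polynomial functions of the direction [v]. *)
Lemma coef_ray v F k : (ray v F)`_k = ev (polar 0 v 0) (iter k quo F).
Proof.
elim: k F => [|k IH] F; rewrite ray_quo coefD coefC coefXM /=; first by rewrite addr0.
by rewrite add0r IH -iterSr.
Qed.

Lemma ev_quo F t v :
  ev (polar t v 0) F = ev (polar 0 v 0) F + t * ev (polar t v 0) (quo F).
Proof. by rewrite -(rayE v F t) ray_quo hornerD hornerC hornerM hornerX rayE. Qed.

Lemma ev_iter_quo F m :
  (forall k, (k < m)%N -> forall v, ev (polar 0 v 0) (iter k quo F) = 0) ->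
  forall t v, ev (polar t v 0) F = t ^+ m * ev (polar t v 0) (iter m quo F).
Proof.
elim: m => [|m IH] H t v; first by rewrite expr0 mul1r.
rewrite IH => [|k km w]; last by apply: H; rewrite ltnS ltnW.
by rewrite ev_quo H // add0r mulrA -exprSr.
Qed.

Lemma poly_root_infinite (p : {poly R}) : (forall x, p.[x] = 0) -> p = 0.
Proof.
move=> H; apply/eqP; apply: contraT => p0.
have := @max_poly_roots _ p [seq i%:R | i <- iota 0 (size p)] p0.
rewrite size_map size_iota ltnn; apply.
  by apply/allP => x _; apply/rootP.
rewrite map_inj_uniq ?iota_uniq // => i j /eqP.
by rewrite eqr_nat => /eqP.
Qed.

(** The complement of the hypersurface [F = 0] is Zariski dense: on the line from
    [v0] to [v] the product of [F] and [G] is the zero polynomial in one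
    variable. *)
Lemma ev_zero_dense F G v0 : ev (polar 0 v0 0) F != 0 ->
  (forall v, ev (polar 0 v 0) F != 0 -> ev (polar 0 v 0) G = 0) ->
  forall v, ev (polar 0 v 0) G = 0.
Proof.
move=> F0 FG v.
pose line (H : pexp R 'I_n.+1) : {poly R} :=
  pev polyC (fun i => if unlift ord0 i is Some k
    then (v0 0 k)%:P + (v 0 k - v0 0 k) *: 'X else 0) H.
have lineE H x : (line H).[x] = ev (polar 0 (v0 + x *: (v - v0)) 0) H.
  rewrite -horner_evalE rmorph_pev; apply: eq_pev => [y|i] /=.
    by rewrite horner_evalE hornerC.
  rewrite horner_evalE mxE; case: (unlift ord0 i) => [k|]; rewrite ?horner0 //.
  by rewrite hornerD hornerC hornerZ hornerX !mxE mulrC.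
have : line F * line G = 0.
  apply: poly_root_infinite => x; rewrite hornerM !lineE.
  have [->|/FG->] := eqVneq (ev (polar 0 (v0 + x *: (v - v0)) 0) F) 0.
    by rewrite mul0r.
  by rewrite mulr0.
move/eqP; rewrite mulf_eq0 => /orP[/eqP F00|/eqP G00].
  by have := lineE F 0; rewrite F00 horner0 scale0r addr0 => E; rewrite -E eqxx in F0.
by have := lineE G 1; rewrite G00 horner0 scale1r addrC subrK.
Qed.

End Polar.

(** * The initial form and the order of vanishing *)

Section InitialForm.
Variables (R : realType) (n : nat).
Implicit Types (a v : 'rV[R]_n) (q : mpoly.mpoly n R).

Lemma derive1n_horner (p : {poly R}) k : derive1n k (horner p) = horner (derivn k p).
Proof.
elim: k => [|k IH]; first by rewrite derivn0.
by rewrite derive1nS IH -derivE derivnS.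
Qed.

Lemma maclaurin_coefE q (Q : pexp R 'I_n) a k v :
  (forall e, mpoly.meval e q = ev e Q) ->
  maclaurin_coef q a k v = ev (polar 0 v 0) (iter k quo (blowup a Q)).
Proof.
move=> HQ; rewrite /maclaurin_coef.
have -> : (fun t => peval q (t *: v + a)) = horner (ray v (blowup a Q)).
  by apply/funext => t; rewrite rayE ev_blowup /peval HQ.
rewrite derive1n_horner horner_coef0 coef_derivn addn0 ffactnn coef_ray.
by rewrite -[X in X / _]mulr_natr mulfK // pnatr_eq0 -lt0n fact_gt0.
Qed.

Lemma nmin_spec q a : (exists j v, maclaurin_coef q a j v != 0) ->
  (exists v, maclaurin_coef q a (nmin q a) v != 0) /\
  forall k, (k < nmin q a)%N -> forall v, maclaurin_coef q a k v = 0.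
Proof.
move=> [j Hj].
have ex : exists k, `[< exists v, maclaurin_coef q a k v != 0 >].
  by exists j; apply/asboolP.
have [m /asboolP Hm mmin] := ex_minnP ex.
have [] : [set j : nat | (exists x, maclaurin_coef q a j x != 0) /\
    forall i : nat, (exists x, maclaurin_coef q a i x != 0) -> (j <= i)%N] (nmin q a).
  apply: xgetPex; exists m; split=> // i Hi; apply: mmin; exact/asboolP.
move=> H1 H2; split=> // k km v; apply/eqP; apply: contraTT km => kv.
by rewrite -leqNgt; apply: H2; exists v.
Qed.

Lemma maclaurin_coef_neq0_ex q a y : peval q y != 0 ->
  exists j v, maclaurin_coef q a j v != 0.
Proof.
move=> qy; have [Q HQ] := meval_is_pexp q.
apply: contrapT => nex; move/eqP: qy; apply.
have ray0 : ray (y - a) (blowup a Q) = 0.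
  apply/polyP => k; rewrite coef0 coef_ray -(maclaurin_coefE _ _ _ HQ).
  by apply/eqP; apply: contrapT => /negP ne; apply: nex; exists k, (y - a).
by rewrite /peval HQ -[y](subrK a) -[y - a]scale1r -ev_blowup -rayE ray0 horner0.
Qed.

(** On a ray where the initial form of [F] does not vanish, [F] is of order
    [t ^+ m]; if the coefficient of [t ^+ k] in [G] were nonzero there for some
    [k < m], the quotient [G / F] would be unbounded as [t] tends to [0]. The
    other rays follow by [ev_zero_dense]. *)
Lemma bounded_vanishing_order (F G : pexp R 'I_n.+1) m M (v0 : 'rV[R]_n) :
  (forall k, (k < m)%N -> forall v, ev (polar 0 v 0) (iter k quo F) = 0) ->
  ev (polar 0 v0 0) (iter m quo F) != 0 ->
  (forall t v, ev (polar t v 0) F != 0 ->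
     `|ev (polar t v 0) G| <= M * `|ev (polar t v 0) F|) ->
  forall k, (k < m)%N -> forall v, ev (polar 0 v 0) (iter k quo G) = 0.
Proof.
move=> F0 Fm bnd; elim/ltn_ind => k IH km.
apply: (ev_zero_dense Fm) => v; set Q := iter m quo F; set g := iter k quo G => Q0.
apply/eqP; apply: contraT => g0.
have [C HC] := poly_bound1 (ray v (quo g)).
have [C' HC'] := poly_bound1 (ray v (quo Q)).
have [B HB] := poly_bound1 (ray v Q).
have n0 : `|0 : R| <= 1 by rewrite normr0.
have C0 : 0 <= C by apply: le_trans (HC 0 n0).
have C'0 : 0 <= C' by apply: le_trans (HC' 0 n0).
have B0 : 0 <= B by apply: le_trans (HB 0 n0).
pose D := `|M| * B + C.
have D0 : 0 <= D by rewrite addr_ge0 // mulr_ge0.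
set q0 := ev _ Q in Q0; set g00 := ev _ g in g0.
(* At this radius [Q] is still nonzero, and [|G / F| <= M] would force
   [|g00| <= t * D]. *)
pose t := Num.min 1 (Num.min (`|q0| / (C' + 1)) (`|g00| / (D + 1))).
have t0 : 0 < t by rewrite !lt_min ltr01 !divr_gt0 ?normr_gt0 // ltr_wpDl.
have t1 : `|t| <= 1 by rewrite gtr0_norm // ge_min lexx.
have tq : t * C' < `|q0|.
  have : t * (C' + 1) <= `|q0|.
    by rewrite -ler_pdivlMr ?ltr_wpDl // !ge_min lexx orbT.
  by rewrite mulrDr mulr1; lra.
have tg : t * D < `|g00|.
  have : t * (D + 1) <= `|g00|.
    by rewrite -ler_pdivlMr ?ltr_wpDl // !ge_min lexx !orbT.
  by rewrite mulrDr mulr1; lra.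
have small b K (c : R) : `|b| <= K -> `|c| - t * K <= `|c + t * b|.
  move=> bK; have := lerB_normD c (t * b); apply: le_trans.
  by rewrite lerD2l lerN2 normrM (gtr0_norm t0) ler_pM2l.
have Qt : ev (polar t v 0) Q != 0.
  rewrite -normr_gt0 ev_quo -/q0 -rayE.
  by apply: lt_le_trans (small _ _ _ (HC' t t1)); rewrite subr_gt0.
have Ft : ev (polar t v 0) F != 0.
  by rewrite (ev_iter_quo F0) mulf_neq0 // expf_neq0 // gt_eqF.
have := bnd t v Ft; rewrite (ev_iter_quo F0) (@ev_iter_quo _ _ G k); last first.
  by move=> i ik; apply: IH => //; exact: ltn_trans km.
rewrite !normrM !normrX (gtr0_norm t0) -/g -/Q -(subnKC km) addSnnS exprD.
rewrite mulrCA -mulrA ler_pM2l ?exprn_gt0 // => bg.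
have {}bg : `|ev (polar t v 0) g| <= t * (`|M| * B).
  apply: le_trans bg _; rewrite exprS -mulrA ler_pM2l //.
  have tk : t ^+ (m - k.+1) <= 1.
    by rewrite exprn_ile1 ?(ltW t0) // ge_min lexx.
  apply: (@le_trans _ _ (1 * (`|M| * B))); last by rewrite mul1r.
  apply: (@le_trans _ _ (t ^+ (m - k.+1) * (`|M| * `|ev (polar t v 0) Q|))).
    by rewrite ler_wpM2l ?exprn_ge0 ?(ltW t0) // ler_wpM2r // ler_norm.
  apply: ler_pM => //; rewrite ?exprn_ge0 ?(ltW t0) //.
  by rewrite ler_wpM2l // -rayE HB.
have := small _ _ g00 (HC t t1); rewrite rayE -ev_quo.
by move: tg bg; rewrite /D mulrDr; lra.
Qed.

End InitialForm.

(** * Derivatives of the ratio in polar coordinates *)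

Section BlowupRatio.
Variables (R : realType) (n : nat) (p q : pexp R 'I_n) (P Q : pexp R 'I_n.+1).
Variables (m : nat) (a : 'rV[R]_n).
Hypothesis pP : forall t v, ev ((t *: v + a) 0) p = t ^+ m * ev (polar t v 0) P.
Hypothesis qQ : forall t v, ev ((t *: v + a) 0) q = t ^+ m * ev (polar t v 0) Q.

Definition radius_pow (k : nat) : pexp R 'I_n.+1 := iter k (PM (PX ord0)) (PC 1).

Lemma ev_radius_pow k t v : ev (polar t v 0) (radius_pow k) = t ^+ k.
Proof. by elim: k => [|k IH] /=; rewrite ?expr0 // IH polar0 exprS. Qed.

Lemma pd_radius_pow k e i : ev e (pd (lift ord0 i) (radius_pow k)) = 0.
Proof.
by elim: k => //= k IH; rewrite IH mulr0 addr0 mul0r.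
Qed.

Section OnePolynomial.
Variables (u : pexp R 'I_n) (U : pexp R 'I_n.+1).
Hypothesis uU : forall t v, ev ((t *: v + a) 0) u = t ^+ m * ev (polar t v 0) U.

Lemma blowup_factor (z : 'rV[R]_n.+1) i :
  ev (z 0) (pd i (blowup a u)) = ev (z 0) (pd i (PM (radius_pow m) U)).
Proof.
apply: ev_pd_ext => {}z; rewrite (polar_surj z).
by rewrite ev_blowup uU /= ev_radius_pow.
Qed.

Lemma pd_direction t v i :
  t * ev ((t *: v + a) 0) (pd i u) = t ^+ m * ev (polar t v 0) (pd (lift ord0 i) U).
Proof.
rewrite -pd_blowup_direction blowup_factor /= pd_radius_pow mul0r add0r.
by rewrite ev_radius_pow.
Qed.

Lemma pd_radius t v : dirder u (t *: v + a) v =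
  ev (polar t v 0) (pd ord0 (radius_pow m)) * ev (polar t v 0) U +
  t ^+ m * ev (polar t v 0) (pd ord0 U).
Proof. by rewrite -pd_blowup_radius blowup_factor /= ev_radius_pow. Qed.

End OnePolynomial.

Let f (x : 'rV[R]_n) := ev (x 0) p / ev (x 0) q.

(** The partial derivatives of [P / Q], by the quotient rule. *)
Definition dratio z j :=
  (ev z (pd j P) * ev z Q - ev z P * ev z (pd j Q)) / ev z Q ^+ 2.

Lemma dirder_delta (u : pexp R 'I_n) (x : 'rV[R]_n) i :
  dirder u x (delta_mx 0 i) = ev (x 0) (pd i u).
Proof.
rewrite /dirder (bigD1 i) //= mxE !eqxx mulr1 big1 ?addr0 // => j ji.
by rewrite mxE (negbTE ji) andbF mulr0.
Qed.

(** The chain rule for [P / Q = f (t *: v + a)]; the common factor [t ^+ m] of [p]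
    and [q] cancels out, together with its derivative in [dratio_radius]. *)
Lemma dratio_direction t v i : t != 0 -> ev (polar t v 0) Q != 0 ->
  dratio (polar t v 0) (lift ord0 i) = t * grad f (t *: v + a) 0 i.
Proof.
move=> t0 Q0; have tm : t ^+ m != 0 by rewrite expf_neq0.
rewrite mxE derive_quotient ?qQ ?mulf_neq0 // !dirder_delta pP.
have := pd_direction qQ t v i; have := pd_direction pP t v i.
set pi := ev _ (pd i p); set qi := ev _ (pd i q) => Ep Eq.
have -> : t * ((pi * (t ^+ m * ev (polar t v 0) Q) - t ^+ m * ev (polar t v 0) P * qi)
    / (t ^+ m * ev (polar t v 0) Q) ^+ 2)
  = (t * pi * (t ^+ m * ev (polar t v 0) Q) - t ^+ m * ev (polar t v 0) P * (t * qi))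
    / (t ^+ m * ev (polar t v 0) Q) ^+ 2 by ring.
rewrite Ep Eq /dratio; field; by rewrite tm Q0.
Qed.

Lemma dratio_radius t v : t != 0 -> ev (polar t v 0) Q != 0 ->
  dratio (polar t v 0) ord0 = \sum_i v 0 i * grad f (t *: v + a) 0 i.
Proof.
move=> t0 Q0; have tm : t ^+ m != 0 by rewrite expf_neq0.
have -> : \sum_i v 0 i * grad f (t *: v + a) 0 i =
   (dirder p (t *: v + a) v * ev ((t *: v + a) 0) q -
    ev ((t *: v + a) 0) p * dirder q (t *: v + a) v) / ev ((t *: v + a) 0) q ^+ 2.
  rewrite /dirder mulr_suml mulr_sumr -sumrB mulr_suml; apply: eq_bigr => i _.
  by rewrite mxE derive_quotient ?qQ ?mulf_neq0 // !dirder_delta; ring.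
rewrite (pd_radius pP) (pd_radius qQ) pP qQ /dratio.
by field; rewrite tm Q0.
Qed.

End BlowupRatio.

(** * The Euclidean sphere *)

Section EuclideanNorm.
Variables (R : realType) (n : nat).
Implicit Types (v : 'rV[R]_n).

Lemma enorm_ge0 v : 0 <= enorm v. Proof. exact: sqrtr_ge0. Qed.

Lemma sqr_enorm v : enorm v ^+ 2 = \sum_i v 0 i ^+ 2.
Proof. by rewrite sqr_sqrtr // sumr_ge0 // => i _; rewrite sqr_ge0. Qed.

Lemma coord_enorm_le v i : `|v 0 i| <= enorm v.
Proof.
by apply: (@sumsq_coord_le R n (v 0)); rewrite ?enorm_ge0 // sqr_enorm.
Qed.

Lemma enorm_eq0 v : enorm v = 0 -> v = 0.
Proof.
move=> v0; apply/rowP => i; apply/eqP; rewrite mxE -normr_le0 -v0.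
exact: coord_enorm_le.
Qed.

Lemma enorm_le_norm v : enorm v <= n%:R * `|v|.
Proof.
rewrite -(ler_pXn2r (ltn0Sn 1)) ?nnegrE ?enorm_ge0 ?mulr_ge0 // sqr_enorm.
apply: (@le_trans _ _ (\sum_(i < n) `|v| ^+ 2)).
  apply: ler_sum => i _; rewrite -real_normK ?num_real //.
  by rewrite ler_pXn2r ?nnegrE // coord_norm_le.
rewrite sumr_const card_ord -[leLHS]mulr_natl exprMn ler_wpM2r ?sqr_ge0 //.
by rewrite -natrX ler_nat -mulnn; case: n => // k; rewrite leq_pmulr.
Qed.

Lemma sumsq_normalize v : v != 0 ->
  \sum_i ((enorm v)^-1 *: v) 0 i ^+ 2 = 1.
Proof.
move=> v0; have e0 : enorm v != 0 by apply: contraNneq v0 => /enorm_eq0->.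
under eq_bigr do rewrite mxE exprMn.
by rewrite -mulr_sumr -sqr_enorm exprVn mulVf // expf_neq0.
Qed.

Lemma polar_sumsq t v : \sum_i polar t v 0 i ^+ 2 = t ^+ 2 + \sum_i v 0 i ^+ 2.
Proof.
by rewrite big_ord_recl polar0; congr (_ + _); apply: eq_bigr => i _; rewrite polarS.
Qed.

Lemma closed_unit_lower_bound (V : set 'rV[R]_n) (F : pexp R 'I_n.+1) : closed V ->
  (forall v, V v -> ev (polar 0 v 0) F != 0) ->
  exists2 eta : R, 0 < eta &
    forall v, V v -> \sum_i v 0 i ^+ 2 = 1 -> eta <= `|ev (polar 0 v 0) F|.
Proof.
move=> cV VF; pose K := V `&` [set v : 'rV[R]_n | \sum_i v 0 i ^+ 2 = 1].
have csum : continuous (fun v : 'rV[R]_n => \sum_i v 0 i ^+ 2).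
  have := @is_pexp_continuous R n (fun e => \sum_i e i ^+ 2).
  by apply; apply: is_pexp_sum => i; apply: is_pexp_sqr; apply: is_pexpX.
have cK : compact K.
  apply: bounded_closed_compact.
    exists 1; split; first exact: num_real.
    move=> M M1 v [_ /= v1]; apply: le_trans (ltW M1).
    apply: norm_rV_le => // i; apply: (@sumsq_coord_le R n (v 0) 1) => //.
    by rewrite v1 expr1n.
  apply: closedI => //.
  apply: (@preimage_closed _ _ (fun v : 'rV[R]_n => \sum_i v 0 i ^+ 2) [set x | x = 1]).
    by move=> v _; exact: csum.
  exact: closed_eq.
pose F0 := psubst (fun i => if unlift ord0 i is Some k then PX k else PC 0) F.
have F0E v : ev (polar 0 v 0) F = ev (v 0) F0.
  rewrite pev_subst; apply: eq_pev => // i.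
  by rewrite mxE; case: (unlift ord0 i).
have cF : continuous (fun v : 'rV[R]_n => `|ev (v 0) F0|).
  move=> v; have := @ev_continuous R n F0 v => cv.
  exact: (cvg_norm cv).
have [K0|nK] := pselect (K !=set0); last first.
  by exists 1 => // v Vv v1; exfalso; apply: nK; exists v.
have [v0 /set_mem[Vv0 _] Hv0] := EVT_min_rV K0 cK (continuous_subspaceT cF).
exists `|ev (v0 0) F0| => [|v Vv v1]; first by rewrite normr_gt0 -F0E VF.
by rewrite F0E; apply: Hv0; rewrite inE.
Qed.

End EuclideanNorm.

(** * The inequality near the exceptional divisor *)

Section NearExceptionalDivisor.
Variables (R : realType) (n : nat) (p q : pexp R 'I_n) (P Q : pexp R 'I_n.+1).
Variables (m : nat) (a : 'rV[R]_n).
Hypothesis pP : forall t v, ev ((t *: v + a) 0) p = t ^+ m * ev (polar t v 0) P.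
Hypothesis qQ : forall t v, ev ((t *: v + a) 0) q = t ^+ m * ev (polar t v 0) Q.
Variables (V : set 'rV[R]_n) (L : R).
Hypothesis V_closed : closed V.
Hypothesis VQ : forall v, V v -> ev (polar 0 v 0) Q != 0.

Let f (x : 'rV[R]_n) := ev (x 0) p / ev (x 0) q.

Lemma dratio_sum_le t v : t != 0 -> ev (polar t v 0) Q != 0 ->
  `|t| <= 1 -> (forall i, `|v 0 i| <= 1) ->
  \sum_j `|dratio P Q (polar t v 0) j| <= (2 * n%:R) * enorm (grad f (t *: v + a)).
Proof.
move=> t0 Q0 t1 v1; set E := enorm _.
have E0 : 0 <= E by exact: enorm_ge0.
have dE (c : R) i : `|c| <= 1 -> `|c * grad f (t *: v + a) 0 i| <= E.
  move=> c1; rewrite normrM -[E]mul1r; apply: ler_pM => //.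
  exact: coord_enorm_le.
have nE : n%:R * E = \sum_(i < n) E by rewrite sumr_const card_ord mulr_natl.
rewrite big_ord_recl (dratio_radius pP qQ) // -mulrA [leRHS]mulr_natl mulr2n.
apply: lerD.
  by rewrite nE; apply: le_trans (ler_norm_sum _ _ _) _; apply: ler_sum => i _; exact: dE.
rewrite nE; apply: ler_sum => i _; rewrite (dratio_direction pP qQ) //; exact: dE.
Qed.

(** The ball of radius [2] contains all [(t, v)] with [|t| <= 1] and [v] a unit
    vector, so a single application of [lojasiewicz_gradient] covers all
    directions at once. *)
Theorem blowup_lojasiewicz : exists tau eps theta c : R,
  [/\ 0 < tau, 0 < eps, 0 < theta, theta <= 1 / 2 &
    forall t v, t != 0 -> `|t| <= tau -> V v -> \sum_i v 0 i ^+ 2 = 1 ->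
      `|f (t *: v + a) - L| < eps ->
      `|f (t *: v + a) - L| `^ (1 - theta) <= c * enorm (grad f (t *: v + a))].
Proof.
have [eta eta0 Heta] := closed_unit_lower_bound V_closed VQ.
have two0 : 0 <= 2 :> R by [].
have [B1 B10 HB1] := ev_bound (quo Q) 2.
have [B B0 HB] := ev_bound Q 2.
have exB' : forall j : 'I_n.+1, exists B' : R, 0 <= B' /\
    forall e, (forall i, `|e i| <= 2) -> `|ev e (pd j Q)| <= B'.
  by move=> j; have [b b0 Hb] := ev_bound (pd j Q) 2; exists b.
have [B' HB'] := choice exB'.
pose SB := \sum_j B' j.
have SB0 : 0 <= SB by rewrite sumr_ge0 // => j _; case: (HB' j).
(* [h] is [P - L * Q], that is, [(f - L) * Q]. *)
pose h := PA P (PM (PC (- L)) Q).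
have [e1 [theta [c [e10 th0 th1 [c0 Hh]]]]] := lojasiewicz_gradient h two0.
pose C1 := c * (B * (2 * n%:R)); pose C2 := c * (SB * (2 / eta)).
have C10 : 0 <= C1 by rewrite !mulr_ge0.
have eta2 : 0 < 2 / eta by rewrite divr_gt0.
have C20 : 0 <= C2 by rewrite mulr_ge0 // mulr_ge0 // ltW.
have [e2 e20 He2] := powR_absorb C1 th0 C20.
pose e := Num.min e1 e2; have e0 : 0 < e by rewrite lt_min e10.
pose tau := Num.min 1 (eta / (2 * (B1 + 1))).
exists tau, (e / (B + 1)), theta, (2 * C1 * (2 / eta) `^ (1 - theta)).
split=> //.
- by rewrite lt_min ltr01 divr_gt0 // mulr_gt0 // ltr_wpDl.
- by rewrite divr_gt0 // ltr_wpDl.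
move=> t v t0; rewrite le_min => /andP[t1 tB] Vv v1 fL.
have zsq : \sum_i polar t v 0 i ^+ 2 <= 2 ^+ 2.
  rewrite polar_sumsq v1 -[t ^+ 2]real_normK ?num_real //.
  by have : `|t| ^+ 2 <= 1 by [rewrite exprn_ile1]; lra.
have z2 i : `|polar t v 0 i| <= 2 by exact: sumsq_coord_le zsq i.
have vi i : `|v 0 i| <= 1.
  by apply: (@sumsq_coord_le R n (v 0) 1); rewrite // v1 expr1n.
have Qge : eta / 2 <= `|ev (polar t v 0) Q|.
  rewrite ev_quo; have := lerB_normD (ev (polar 0 v 0) Q) (t * ev (polar t v 0) (quo Q)).
  apply: le_trans; rewrite normrM.
  have := Heta v Vv v1.
  have : `|t| * `|ev (polar t v 0) (quo Q)| <= eta / 2.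
    apply: (@le_trans _ _ (`|t| * (B1 + 1))).
      by rewrite ler_wpM2l // (le_trans (HB1 _ z2)) // lerDl.
    by rewrite -ler_pdivlMr ?ltr_wpDl // -mulrA -invfM.
  by lra.
have Q0 : ev (polar t v 0) Q != 0.
  by rewrite -normr_gt0 (lt_le_trans _ Qge) // divr_gt0.
have tm : t ^+ m != 0 by rewrite expf_neq0.
have fE : f (t *: v + a) = ev (polar t v 0) P / ev (polar t v 0) Q.
  by rewrite /f pP qQ invfM mulrACA mulfV // mul1r.
set y := t *: v + a in fL fE *; set z := polar t v 0 in z2 Qge Q0 fE *.
have hE : ev z h = (f y - L) * ev z Q.
  by rewrite /= fE mulrBl divfK // mulNr.
have dhE j : ev z (pd j h) = ev z Q * dratio P Q z j + (f y - L) * ev z (pd j Q).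
  by rewrite /= fE /dratio; field.
have hnorm : `|f y - L| <= `|ev z h| * (2 / eta).
  rewrite hE normrM -mulrA ler_peMr //.
  by rewrite -ler_pdivrMr // mul1r invf_div.
have hlt : `|ev z h| < e.
  rewrite hE normrM.
  apply: (@le_lt_trans _ _ (`|f y - L| * (B + 1))).
    by rewrite ler_wpM2l // (le_trans (HB _ z2)) // lerDl.
  by rewrite -ltr_pdivlMr // ltr_wpDl.
have {}Hh := Hh (polar t v) zsq (lt_le_trans hlt _).
have E0 := enorm_ge0 (grad f y).
have hle : `|ev z h| `^ (1 - theta) <= C1 * enorm (grad f y) + C2 * `|ev z h|.
  apply: le_trans (Hh _) _; first by rewrite ge_min lexx.
  rewrite /C1 /C2 -!mulrA -mulrDr ler_wpM2l //.
  apply: (@le_trans _ _ (\sum_j (`|ev z Q| * `|dratio P Q z j| + `|f y - L| * B' j))).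
    apply: ler_sum => j _; rewrite -/z dhE; apply: le_trans (ler_normD _ _) _.
    rewrite !normrM lerD2l ler_wpM2l //.
    by case: (HB' j) => _; apply.
  rewrite big_split /= -!mulr_sumr lerD //.
    apply: ler_pM => //; [by rewrite sumr_ge0|exact: HB|].
    by rewrite mulrA; apply: dratio_sum_le.
  rewrite -/SB mulrC ler_wpM2l //; apply: le_trans hnorm _.
  by rewrite mulrC mulrA.
have hle2 : `|ev z h| `^ (1 - theta) <= 2 * C1 * enorm (grad f y).
  by apply: He2 hle; rewrite normr_ge0 (lt_le_trans hlt) // ge_min lexx orbT.
apply: (@le_trans _ _ ((`|ev z h| * (2 / eta)) `^ (1 - theta))).
  have nn1 : `|f y - L| \in Num.nneg by rewrite nnegrE.
  have nn2 : `|ev z h| * (2 / eta) \in Num.nneg by rewrite nnegrE mulr_ge0 // ltW.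
  by apply: ge0_ler_powR nn1 nn2 hnorm; rewrite subr_ge0; lra.
rewrite powRM ?(ltW eta2) // [leRHS]mulrAC ler_wpM2r ?powR_ge0 //.
Qed.

End NearExceptionalDivisor.

Theorem theorem2p9 (R : realType) (n : nat) (p q : mpoly.mpoly n R)
    (q_neq0 : q != 0)
    (f_bounded : exists M : R, forall y : 'rV[R]_n,
       ratdom q y -> `|ratfun p q y| <= M)
    (x : nat -> 'rV[R]_n)
    (x_dom : forall k : nat, ratdom q (x k))
    (f_monotonic : nondecreasing_seq (fun k : nat => ratfun p q (x k)) \/
                   nonincreasing_seq (fun k : nat => ratfun p q (x k)))
    (xs : 'rV[R]_n)
    (xs_cluster : cluster (x @ \oo) xs)
    (V : set 'rV[R]_n) (V_closed : closed V) (V_sub : V `<=` Oset q xs)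
    (x_dir : \forall k \near \oo,
       x k <> xs /\ V ((enorm (x k - xs))^-1 *: (x k - xs))) :
  exists (U : set 'rV[R]_n) (theta c : R),
    [/\ open U, U xs, 0 < theta, theta <= 1 / 2 &
      \forall k \near \oo, U (x k) ->
        `|ratfun p q (x k) - lim (ratfun p q (x i) @[i --> \oo])| `^ (1 - theta)
          <= c * enorm (grad (ratfun p q) (x k))].
Proof.
have [M HM] := f_bounded.
have [P0 HP] := meval_is_pexp p; have [Q0 HQ] := meval_is_pexp q.
have fE : ratfun p q = fun y => ev (y 0) P0 / ev (y 0) Q0.
  by apply/funext => y; rewrite /ratfun /peval HP HQ.
set L := lim _.
have f_cvg : (ratfun p q (x i) @[i --> \oo]) --> L.
  suff : cvgn (fun i => ratfun p q (x i)) by [].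
  case: f_monotonic => mono.
    apply: nondecreasing_is_cvgn => //; exists M => _ [k _ <-].
    by apply: le_trans (ler_norm _) (HM _ (x_dom k)).
  apply: nonincreasing_is_cvgn => //; exists (- M) => _ [k _ <-].
  by rewrite lerNl (le_trans (ler_norm _)) // normrN HM //; exact: x_dom.
have [[v0 Fm] F0] := nmin_spec (maclaurin_coef_neq0_ex xs (x_dom 0%N)).
set m := nmin q xs in Fm F0 *.
have coefE := maclaurin_coefE xs _ _ HQ.
have {}F0 k : (k < m)%N -> forall v, ev (polar 0 v 0) (iter k quo (blowup xs Q0)) = 0.
  by move=> km v; rewrite -coefE F0.
have G0 k : (k < m)%N -> forall v, ev (polar 0 v 0) (iter k quo (blowup xs P0)) = 0.
  move: k; apply: (@bounded_vanishing_order R n _ _ m M v0 F0); first by rewrite -coefE.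
  move=> t v; rewrite !ev_blowup => Q0n.
  have := HM (t *: v + xs); rewrite /ratdom /= /ratfun /peval HP HQ => /(_ Q0n).
  by rewrite normrM normfV ler_pdivrMr ?normr_gt0.
have pP t v : ev ((t *: v + xs) 0) P0 =
    t ^+ m * ev (polar t v 0) (iter m quo (blowup xs P0)).
  by rewrite -ev_blowup; apply: ev_iter_quo.
have qQ t v : ev ((t *: v + xs) 0) Q0 =
    t ^+ m * ev (polar t v 0) (iter m quo (blowup xs Q0)).
  by rewrite -ev_blowup; apply: ev_iter_quo.
have VQ v : V v -> ev (polar 0 v 0) (iter m quo (blowup xs Q0)) != 0.
  by move=> /V_sub; rewrite /Oset /= coefE.
have [tau [eps [theta [c [tau0 eps0 th0 th1 H]]]]] :=
  blowup_lojasiewicz pP qQ L V_closed VQ.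
(* The balls of the topology are those of the sup norm, which differs from the
   Euclidean norm by a factor at most [n]. *)
exists (ball xs (tau / n.+1%:R)), theta, c; split=> //.
- exact: ball_open.
- by apply: ballxx; rewrite divr_gt0.
move/cvgrPdist_lt : f_cvg => /(_ _ eps0) f_near.
near=> k => Uk.
have [/eqP xk Vk] : x k <> xs /\ V ((enorm (x k - xs))^-1 *: (x k - xs)) by near: k.
have fk : `|L - ratfun p q (x k)| < eps by near: k.
pose t := enorm (x k - xs); pose v := t^-1 *: (x k - xs).
have d0 : x k - xs != 0 by rewrite subr_eq0.
have t0 : t != 0 by apply: contraNneq d0 => /enorm_eq0->.
have xE : x k = t *: v + xs by rewrite scalerA mulfV // scale1r subrK.
have tt : `|t| <= tau.
  rewrite ger0_norm ?enorm_ge0 //; apply: le_trans (enorm_le_norm _) _.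
  move: Uk; rewrite -ball_normE /= distrC ltr_pdivlMr // => /ltW; apply: le_trans.
  by rewrite mulrC ler_wpM2l // ler_nat.
rewrite xE fE; apply: H => //.
- exact: sumsq_normalize.
- by rewrite -xE distrC; move: fk; rewrite fE.
Unshelve. all: by end_near.
Qed.
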